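(* Let $\mathcal C=\{[a]:[a]\subseteq\Sigma\}$ be the partition of $\Sigma$ into cylinders of length one, let $\nu_0\in\mathbb P(\mathcal C)$ be a probability measure on $\mathcal C$, and write $\psi:=\sum_{a}\mathbb 1_{[a]}\log\nu_0([a])$. Assume that $F_\omega=F_{\omega_0}$, i.e. $F_\omega$ depends only on the symbol $\omega_0$. Then: 1. every $\nu_0$-stationary measure on $X$ can be obtained as the projection to $X$ of a POE maximizer (for the potential $\psi$); 2. every POE maximizer (for the potential $\psi$) projects to a $\nu_0$-stationary measure on $X$.
   Context: Setting: $\Sigma$ is a two-sided compact (finite alphabet), topologically transitive topological Markov shift with left shift $T:\Sigma\to\Sigma$; $[a]=\{\omega\in\Sigma:\omega_0=a\}$; $X$ is a compact metric space; $\omega\mapsto F_\omega$ is a Hölder continuous map from $\Sigma$ into the space of $\alpha$-Hölder maps of $X$, where each $F_\omega$ is an $\alpha$-Hölder homeomorphism of $X$; and $\widehat F(\omega,t)=(T\omega,F_\omega(t))$ on $\Sigma\times X$. When $F_\omega=F_{\omega_0}$, write $F_a$ for $F_\omega$ with $\omega_0=a$. A Borel probability measure $\tau$ on $X$ is $\nu_0$-stationary if $\tau=\sum_{a}\nu_0([a])\,(F_a)_*\tau$. Let $\Sigma^-=\{(\omega_i)_{i\le-1}:\omega\in\Sigma\}$ and, for $\omega^-\in\Sigma^-$, $V^u_{\le-1}(\omega^-)=\{\omega\in\Sigma:\omega_i=\omega^-_i\ \forall i\le-1\}$. Let $\widehat{\mathcal C}=\{[a]\times X\}_{a}$ and $\widehat{\mathcal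 C}_n=\bigvee_{i=0}^{n-1}\widehat F^{-i}\widehat{\mathcal C}$. Metric entropy out of equilibrium: for an $\widehat F$-invariant Borel probability $\widehat\eta$ on $\Sigma\times X$ with disintegration into conditional measures $\widehat\eta=\int\eta_{(\omega^-,t)}\,d\tau(\omega^-,t)$ along $\{V^u_{\le-1}(\omega^-)\times\{t\}\}_{\omega^-\in\Sigma^-,\,t\in X}$, $$\widehat h_{\widehat\eta}(\widehat F):=\limsup_{n\to\infty}\int\frac1n \mathrm H_{\eta_{(\omega^-,t)}}(\widehat{\mathcal C}_n)\,d\tau(\omega^-,t),\qquad \mathrm H_\nu(\mathcal P)=-\sum_{A\in\mathcal P}\nu(A)\log\nu(A).$$ POE (pressure out of equilibrium) maximizer for $\psi$: an $\widehat F$-invariant Borel probability measure on $\Sigma\times X$ attaining the maximum of $\widehat h_{\widehat\eta}(\widehat F)+\int\psi(\omega)\,d\widehat\eta(\omega,t)$ over all $\widehat F$-invariant Borel probability measures $\widehat\eta$ on $\Sigma\times X$.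
   Formalization: The formal theorem adds that a→b is allowed whenever ν₀([a]),ν₀([b])>0 (i.i.d. ν₀-sequences lie in Σ). Otherwise false: on the shift 0→1→0, ν₀=(1/2,1/2), X three points, F_0 a 3-cycle, F_1 its inverse, all invariant measures maximize, but not all project to stationary ones. *)

(* Defs.v *)
From HB Require Import structures.
From mathcomp Require Import all_boot all_order all_algebra.
From mathcomp Require Import all_classical all_reals all_analysis.

Set Implicit Arguments.
Unset Strict Implicit.
Unset Printing Implicit Defensive.

Import Order.TTheory GRing.Theory Num.Theory.
Import numFieldNormedType.Exports.

Local Open Scope classical_set_scope.
Local Open Scope ring_scope.

(* Measurable types of the library are pointed, so a metric space has to be
   nonempty before it can carry its Borel sigma-algebra. *)
#[short(type="pmetricType")]
HB.structure Definition PointedMetric (K : numDomainType) :=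
  { M of Metric K M & Pointed M }.

HB.instance Definition _ (T U : ptopologicalType) := Pointed.on (T * U)%type.

Definition borel (T : ptopologicalType) := g_sigma_algebraType (@open T).

Section holder.
Context {R : realType}.

Definition holder_wrt (T U : Type) (dT : T -> T -> R) (dU : U -> U -> R)
    (alpha : R) (f : T -> U) : Prop :=
  exists C : R, forall x y, dU (f x) (f y) <= C * dT x y `^ alpha.

Definition holder (X : metricType R) (alpha : R) (f : X -> X) : Prop :=
  holder_wrt (@mdist R X) (@mdist R X) alpha f.

Definition sup_dist (X : metricType R) (f g : X -> X) : R :=
  sup [set mdist (f t) (g t) | t in [set: X]].

End holder.

Definition homeomorphism (X : topologicalType) (f : X -> X) : Prop :=
  exists g : X -> X, [/\ cancel f g, cancel g f, continuous f & continuous g].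

(* A two-sided topological Markov shift with a finite alphabet, given by its
   allowed transitions. The alphabet is reduced to the symbols that occur, so
   that symbols and nonempty cylinders of length one are in bijection. *)
Record markov_shift := MarkovShift {
  alphabet : finType ;
  allowed : rel alphabet ;
  admissible : set {ptws int -> discrete_topology alphabet} :=
    [set w | forall i : int, allowed (w i) (w (i + 1))] ;
  admissible_nonempty : admissible !=set0 ;
  symbol_occurs : forall a : alphabet, exists2 w, admissible w & w 0 = a }.

Section shift.
Variable S : markov_shift.

Definition shift_space : Type := set_type (@admissible S).

HB.instance Definition _ :=
  Topological.copy shift_space (set_type (@admissible S)).

Let admissible_point : shift_space :=
  let: exist w aw := cid (@admissible_nonempty S) in SigSub (mem_set aw).

HB.instance Definition _ := isPointed.Build shift_space admissible_point.

Definition symbol (w : shift_space) (i : int) : alphabet S := val w i.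

Lemma symbol_allowed (w : shift_space) (i : int) :
  allowed (symbol w i) (symbol w (i + 1)).
Proof. exact: (set_mem (valP w)). Qed.

Fact shift_subproof (w : shift_space) :
  (fun i => symbol w (i + 1)) \in @admissible S.
Proof. by apply/mem_set => i; exact: symbol_allowed. Qed.

Definition shift (w : shift_space) : shift_space := SigSub (shift_subproof w).

Definition cylinder (a : alphabet S) : set shift_space :=
  [set w | symbol w 0 = a].

Definition topologically_transitive : Prop :=
  forall U V : set shift_space, open U -> open V -> U !=set0 -> V !=set0 ->
    exists n : nat, (U `&` iter n shift @^-1` V) !=set0.

(* 2 ^ - min {|i| : w_i <> w'_i}, and 0 when w = w' *)
Definition shift_dist {R : realType} (w w' : shift_space) : R :=
  sup [set 2 ^- `|i|%N | i in [set i : int | symbol w i != symbol w' i]].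

(* (w_i)_{i <= -1} is stored as n |-> w_(-(n+1)), and Negz n is -(n+1) *)
Definition past_seq (w : shift_space)
    : {ptws nat -> discrete_topology (alphabet S)} :=
  fun n => symbol w (Negz n).

Definition past_space : Type := set_type (range past_seq).

HB.instance Definition _ :=
  Topological.copy past_space (set_type (range past_seq)).

Fact past_subproof (w : shift_space) : past_seq w \in range past_seq.
Proof. by apply/mem_set; exists w. Qed.

Definition past (w : shift_space) : past_space := SigSub (past_subproof w).

HB.instance Definition _ := isPointed.Build past_space (past point).

(* the set V^u_{<= -1}(w^-) *)
Definition unstable_set (p : past_space) : set shift_space :=
  [set w | past w = p].

End shift.

Section skew_product.
Context {R : realType} {S : markov_shift} {X : pmetricType R}.

Notation Sigma := (shift_space S).
Notation Past := (past_space S).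

(* phase space Sigma x X, and the quotient space Sigma^- x X *)
Notation phase := (borel (Sigma * X)%type).
Notation past_phase := (borel (Past * X)%type).

Implicit Types (F : Sigma -> X -> X) (eta : probability phase R).

(* w |-> F_w is a Hoelder map from Sigma to the space of alpha-Hoelder maps
   with the uniform distance, and each F_w is an alpha-Hoelder homeomorphism *)
Definition holder_fibre_maps (alpha : R) F : Prop :=
  (forall w, holder alpha (F w) /\ homeomorphism (F w)) /\
  exists2 beta : R, 0 < beta &
    holder_wrt (@shift_dist S R) (@sup_dist R X) beta F.

Definition skew F (x : Sigma * X) : Sigma * X := (shift x.1, F x.1 x.2).

Definition skew_invariant F eta : Prop :=
  forall A : set phase, measurable A -> eta (skew F @^-1` A) = eta A.

Definition projects_to eta (tau : probability (borel X) R) : Prop :=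
  forall B : set (borel X), measurable B -> eta (snd @^-1` B) = tau B.

Section entropy.
Local Open Scope ereal_scope.

Definition past_map (x : phase) : past_phase := (past x.1, x.2).

(* kappa is the family of conditional measures of eta along the sets
   V^u_{<= -1}(w^-) x {t}, and pushforward eta past_map is the quotient
   measure on Sigma^- x X *)
Definition disintegration eta (kappa : R.-pker past_phase ~> phase) : Prop :=
  {ae pushforward eta past_map, forall y : past_phase,
     kappa y (unstable_set y.1 `*` [set y.2]) = 1} /\
  forall A : set phase, measurable A ->
    eta A = \int[pushforward eta past_map]_y kappa y A.

Definition first_symbol_cell (a : alphabet S) : set phase :=
  cylinder a `*` [set: X].

(* The cells of the join are indexed by words: distinct words have disjoint
   cells, and the empty cells contribute 0 to the entropy. *)
Definition join_cell F (n : nat) (u : {ffun 'I_n -> alphabet S}) : set phase :=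
  \bigcap_(i : 'I_n) (iter i (skew F) @^-1` first_symbol_cell (u i)).

Definition partition_entropy (I : finType) (nu : set phase -> \bar R)
    (P : I -> set phase) : R :=
  (- \sum_(i : I) fine (nu (P i)) * ln (fine (nu (P i))))%R.

Definition entropy_along F eta (kappa : R.-pker past_phase ~> phase) : \bar R :=
  limn_esup (fun n : nat => \int[pushforward eta past_map]_y
    (n%:R^-1 * partition_entropy (kappa y) (@join_cell F n))%:E).

(* Disintegrations exist and agree almost everywhere, so this relation is the
   graph of the metric entropy out of equilibrium. *)
Definition has_metric_entropy F eta (h : \bar R) : Prop :=
  exists2 kappa, disintegration eta kappa & h = entropy_along F eta kappa.

Definition poe_maximizer F (psi : Sigma -> \bar R) eta : Prop :=
  skew_invariant F eta /\
  exists2 h, has_metric_entropy F eta h &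
    forall eta' h', skew_invariant F eta' -> has_metric_entropy F eta' h' ->
      h' + \int[eta']_x psi x.1 <= h + \int[eta]_x psi x.1.

(* lne 0 = -oo *)
Definition log_potential (nu0 : alphabet S -> R) (w : Sigma) : \bar R :=
  \sum_(a : alphabet S) (\1_(cylinder a) w)%:E * lne (nu0 a)%:E.

Definition stationary (nu0 : alphabet S -> R) (f : alphabet S -> X -> X)
    (tau : probability (borel X) R) : Prop :=
  forall B : set (borel X), measurable B ->
    tau B = \sum_(a : alphabet S) (nu0 a)%:E * tau (f a @^-1` B).

End entropy.

End skew_product.

Section cylinder_measure.
Context {R : realType} {S : markov_shift}.

(* a probability measure on the partition of Sigma into the cylinders [a],
   nu0 a being the mass of [a] *)
Definition cylinder_probability (nu0 : alphabet S -> R) : Prop :=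
  (forall a, 0 <= nu0 a) /\ \sum_(a : alphabet S) nu0 a = 1.

(* The Bernoulli measure with marginal nu0 is carried by Sigma. This always
   holds on a full shift. It cannot be dropped: on the shift with alphabet
   {0, 1} and transitions 0 -> 1 -> 0, with nu0 = (1/2, 1/2), F_0 a cyclic
   permutation of three points and F_1 its inverse, every invariant measure is
   a maximizer but only one of their projections is stationary. *)
Definition bernoulli_admissible (nu0 : alphabet S -> R) : Prop :=
  forall a b, 0 < nu0 a -> 0 < nu0 b -> allowed a b.

End cylinder_measure.

(* Main.v *)
From HB Require Import structures.
From mathcomp Require Import all_boot all_order all_algebra.
From mathcomp Require Import all_classical all_reals all_analysis.
From mathcomp Require Import measurable_realfun giry ring lra.
Require Import Defs.

(** The pressure of the potential log nu0 is at most 0, and it is attained by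
    the measures under which the present symbol w_0 is independent of the past
    and of the fibre point t, with law nu0.

    Upper bound. Let r_a(t) >= 0 have sum at most 1 over a. For a word u, the
    product of the r_(u_i) along the fibre orbit of t is a subprobability on
    words, so Gibbs' inequality bounds the entropy of each conditional measure
    on words of length n; integrating and using invariance, the entropy out of
    equilibrium is at most the integral of - log r_(w_0)(t). The choice
    r = nu0 gives pressure at most 0. If the pressure is 0, the choice
    r_a(t) = nu0_a (1 + e d_a 1_D(t)), with d of mean 0 and e of either sign,
    forces the derivative at e = 0 to vanish. With d_a = 1_(a = b) - nu0_b this
    says that w_0 = b and t in D are independent, which together with
    invariance is the stationarity of the projection to X.

    Attainment. Given a stationary tau, the conditional measures (a fixed past
    and fibre point, an i.i.d. future) and the natural extension are obtained
    as limits of explicit measures. Weak limits are replaced by ultralimits: an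
    ultralimit of measures on a compact space is a content on closed sets, and
    U |-> sup {m K | K closed, K <= U} extends to a Borel measure. The same
    device applied to the Cesaro means of a Dirac mass provides a stationary
    measure, so the maximal pressure is 0. *)

Set Implicit Arguments.
Unset Strict Implicit.
Unset Printing Implicit Defensive.

Import Order.TTheory GRing.Theory Num.Theory.
Import numFieldNormedType.Exports.

Local Open Scope classical_set_scope.
Local Open Scope ring_scope.

(** * Measures from contents on closed sets *)

(** Each clause involves finitely many values, so all of them pass to pointwise limits along a
    filter. Countable additivity is recovered later from compactness. *)
Record closed_content (R : realType) (Y : topologicalType) (m : set Y -> R) :
    Prop := ClosedContent {
  closed_content_le : forall K L, closed K -> closed L -> K `<=` L -> m K <= m L ;
  closed_contentU : forall K L, closed K -> closed L -> m (K `|` L) <= m K + m L ;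
  closed_content_disjoint : forall K L, closed K -> closed L ->
    K `&` L = set0 -> m (K `|` L) = m K + m L ;
  closed_contentT : m setT = 1 }.

Section closed_content_basics.
Context {R : realType} {Y : topologicalType}.
Variables (m : set Y -> R) (cm : closed_content m).

Lemma closed_content0 : m set0 = 0.
Proof.
have := closed_content_disjoint cm closed0 closed0 (setI0 _).
by rewrite setU0; lra.
Qed.

Lemma closed_content_ge0 K : closed K -> 0 <= m K.
Proof.
move=> cK; rewrite -closed_content0.
by apply: (closed_content_le cm) => //; exact: closed0.
Qed.

Lemma closed_content_le1 K : closed K -> m K <= 1.
Proof.
move=> cK; rewrite -(closed_contentT cm).
by apply: (closed_content_le cm) => //; exact: closedT.
Qed.

End closed_content_basics.

Section content_measure.
Context {R : realType} {Y : ptopologicalType}.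
Hypotheses (hY : hausdorff_space Y) (cY : compact [set: Y]).
Variables (m : set Y -> R) (cm : closed_content m).

(** The measure built from [m] takes this value on open sets. On a closed set it may exceed [m],
    which is why identities between measures are tested on open sets below. *)
Definition inner_content (U : set Y) : R :=
  sup [set m K | K in [set K | closed K /\ K `<=` U]].

Lemma inner_content_has_sup (U : set Y) :
  has_sup [set m K | K in [set K | closed K /\ K `<=` U]].
Proof.
split; first by exists (m set0); exists set0 => //; split => //; exact: closed0.
by exists 1 => _ [K [cK _] <-]; exact: (closed_content_le1 cm).
Qed.

Lemma inner_content_ub K U : closed K -> K `<=` U -> m K <= inner_content U.
Proof.
move=> cK KU; apply: (ub_le_sup (inner_content_has_sup U).2).
by exists K.
Qed.

Lemma inner_content_le_ub U x :
  (forall K, closed K -> K `<=` U -> m K <= x) -> inner_content U <= x.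
Proof.
move=> h; apply: ge_sup; first exact: (inner_content_has_sup U).1.
by move=> _ [K [cK KU] <-]; exact: h.
Qed.

Lemma inner_content_ge0 U : 0 <= inner_content U.
Proof.
by rewrite -(closed_content0 cm); apply: inner_content_ub => //; exact: closed0.
Qed.

Lemma le_inner_content U V : U `<=` V -> inner_content U <= inner_content V.
Proof.
move=> UV; apply: inner_content_le_ub => K cK KU; apply: inner_content_ub => //.
exact: subset_trans UV.
Qed.

Lemma inner_contentT : inner_content setT = 1.
Proof.
apply/eqP; rewrite eq_le; apply/andP; split.
  by apply: inner_content_le_ub => K cK _; exact: (closed_content_le1 cm).
by rewrite -(closed_contentT cm); apply: inner_content_ub => //; exact: closedT.
Qed.

(** Normality of a compact Hausdorff space puts a neighbourhood of K minus V, with its closure,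
    inside [U]. This carries subadditivity from closed sets over to open ones. *)
Lemma closed_split K U V : closed K -> open U -> open V -> K `<=` U `|` V ->
  exists L M : set Y, [/\ closed L, closed M, L `<=` U, M `<=` V & K = L `|` M].
Proof.
move=> cK oU oV KUV.
have cKV : closed (K `\` V) by rewrite setDE; apply: closedI => //; exact: open_closedC.
have := @compact_normal Y hY cY _ cKV U.
case.
  apply/set_nbhsP; exists U; split => // x [Kx nVx].
  by have [|] := KUV x Kx.
move=> C /set_nbhsP[W [oW KVW WC]] CU.
exists (K `&` closure C), (K `&` ~` W); split.
- by apply: closedI => //; exact: closed_closure.
- by apply: closedI => //; exact: open_closedC.
- by move=> x [_ /CU].
- by move=> x [Kx Wx]; apply: contrapT => nVx; apply: Wx; exact: KVW.
- apply/seteqP; split => [x Kx|x [[]|[]]//].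
  have [Wx|nWx] := pselect (W x); last by right.
  by left; split => //; apply: subset_closure; exact: WC.
Qed.

(** By compactness finitely many of the [U n] cover a given closed set, which [closed_split] then
    distributes among them, one open set at a time. *)
Lemma inner_content_sigma_subadditive (U : (set Y)^nat) :
  (forall n, open (U n)) ->
  ((inner_content (\bigcup_n U n))%:E <= \sum_(n <oo) (inner_content (U n))%:E)%E.
Proof.
move=> oU.
have finU n K : closed K -> K `<=` \bigcup_(i < n) U i ->
    m K <= \sum_(i < n) inner_content (U i).
  elim: n K => [K _|n IHn K cK].
    rewrite bigcup_mkord !big_ord0 subset0 => ->.
    by rewrite (closed_content0 cm).
  rewrite bigcup_mkord big_ord_recr/= -bigcup_mkord => KU.
  have [|L [M [cL cM LU MU ->]]] := closed_split cK _ (oU n) KU.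
    by apply: bigcup_open => i _.
  rewrite big_ord_recr/=; apply: (le_trans (closed_contentU cm cL cM)).
  by apply: lerD; [exact: IHn|exact: inner_content_ub].
have S0 n : (0 <= n)%N -> true -> (0 <= (inner_content (U n))%:E)%E.
  by move=> _ _; rewrite lee_fin; exact: inner_content_ge0.
have [/eqP->|Soo] := boolP (\sum_(n <oo) (inner_content (U n))%:E == +oo)%E.
  by rewrite leey.
have Sfin : (\sum_(n <oo) (inner_content (U n))%:E)%E \is a fin_num.
  by rewrite ge0_fin_numE ?ltey//; exact: nneseries_ge0.
rewrite -(fineK Sfin) lee_fin; apply: inner_content_le_ub => K cK KU.
have [D _ KD] : finite_subset_cover [set: nat] U K.
  have := @subclosed_compact _ _ _ cK cY (@subsetT _ _).
  by rewrite compact_cover; apply => // n _.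
pose N := (\max_(i <- finmap.enum_fset D) i).+1.
have KN : K `<=` \bigcup_(i < N) U i.
  move=> x /KD[i iD Ux]; exists i => //=; rewrite /N ltnS.
  by apply: (@leq_bigmax_seq _ _ xpredT id).
apply: le_trans (finU _ _ cK KN) _.
rewrite -lee_fin fineK// -sumEFin -(big_mkord xpredT (fun i => (inner_content (U i))%:E)).
exact: nneseries_lim_ge.
Qed.

Local Open Scope ereal_scope.

Definition content_outer (A : set Y) : \bar R :=
  ereal_inf [set (inner_content U)%:E | U in [set U | open U /\ A `<=` U]].

Lemma content_outer_open U : open U -> content_outer U = (inner_content U)%:E.
Proof.
move=> oU; apply/eqP; rewrite eq_le; apply/andP; split.
  by apply: ereal_inf_lbound; exists U => //; split.
by apply: le_ereal_inf_tmp => _ [V [oV UV] <-]; rewrite lee_fin le_inner_content.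
Qed.

Lemma content_outer_le A U : open U -> A `<=` U ->
  content_outer A <= (inner_content U)%:E.
Proof. by move=> oU AU; apply: ereal_inf_lbound; exists U. Qed.

Let outer_ge0 A : 0 <= content_outer A.
Proof.
by apply: le_ereal_inf_tmp => _ [V [oV UV] <-]; rewrite lee_fin inner_content_ge0.
Qed.

Let outer0 : content_outer set0 = 0.
Proof.
rewrite content_outer_open; last exact: open0.
congr (_%:E); apply/eqP; rewrite eq_le inner_content_ge0 andbT.
apply: inner_content_le_ub => K cK; rewrite subset0 => ->.
by rewrite (closed_content0 cm).
Qed.

Let outer_le : {homo content_outer : A B / A `<=` B >-> A <= B}.
Proof.
move=> A B AB; apply: le_ereal_inf_tmp => _ [V [oV UV] <-].
by apply: content_outer_le => //; exact: subset_trans UV.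
Qed.

Let outer_fin A : content_outer A \is a fin_num.
Proof.
rewrite ge0_fin_numE//; apply: (@le_lt_trans _ _ 1%R%:E); last exact: ltry.
by rewrite -inner_contentT content_outer_le//; exact: openT.
Qed.

Lemma content_outer_approx A (e : R) : (0 < e)%R ->
  exists U, [/\ open U, A `<=` U & (inner_content U)%:E <= content_outer A + e%:E].
Proof.
move=> e0; have [_ [U [oU AU] <-] h] := lb_ereal_inf_adherent e0 (outer_fin A).
by exists U; split => //; exact: ltW.
Qed.

Let outer_sigma : sigma_subadditive content_outer.
Proof.
move=> A; apply/lee_addgt0Pr => e e0.
have eVn n : (0 < e / (2 ^ n.+1)%:R)%R by rewrite divr_gt0// ltr0n expn_gt0.
have /choice[U hU] n := content_outer_approx (A n) (eVn n).
apply: le_trans (epsilon_trick _ _ (ltW e0)); last by move=> n; exact: outer_ge0.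
have oU n : open (U n) by have [] := hU n.
apply: (@le_trans _ _ (\sum_(n <oo) (inner_content (U n))%:E)).
  apply: le_trans (inner_content_sigma_subadditive oU).
  apply: content_outer_le; first by apply: bigcup_open => n _.
  by apply: subset_bigcup => n _; have [] := hU n.
apply: lee_nneseries => [n _ _|n _]; first by rewrite lee_fin inner_content_ge0.
by have [] := hU n.
Qed.

HB.instance Definition _ := @isOuterMeasure.Build R Y content_outer
  outer0 outer_ge0 outer_le outer_sigma.

(** Inside an open [V], choose a closed [K] in the part of [V] lying in [U], then a closed [L] in V
    minus K. They are disjoint, so their contents add up to at most the inner content of [V]; take
    suprema over [L], then over [K]. *)
Lemma open_caratheodory U : open U -> content_outer.-caratheodory U.
Proof.
move=> oU; apply: le_caratheodory_measurable => X.
apply: le_ereal_inf_tmp => _ [V [oV XV] <-].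
apply: (@le_trans _ _ (content_outer (V `&` U) + content_outer (V `&` ~` U))).
  by apply: leeD; apply: outer_le; exact: setSI.
rewrite content_outer_open; last exact: openI.
rewrite -(fineK (outer_fin _)) -EFinD lee_fin -lerBrDr.
apply: inner_content_le_ub => K cK KVU; rewrite lerBrDr -lerBrDl.
rewrite -lee_fin fineK//.
apply: (@le_trans _ _ (inner_content (V `\` K))%:E).
  apply: content_outer_le; first by apply: openI => //; exact: closed_openC.
  by move=> x [Vx nUx]; split => // /KVU[].
rewrite lee_fin; apply: inner_content_le_ub => L cL LVK; rewrite lerBrDl.
rewrite -(closed_content_disjoint cm) //; last first.
  by apply/seteqP; split => // x [Kx /LVK[_]].
apply: inner_content_ub; first exact: closedU.
by move=> x [/KVU[]|/LVK[]].
Qed.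

Let content_measure (A : set (borel Y)) := content_outer A.

Let borel_cara (A : set (borel Y)) : measurable A -> content_outer.-caratheodory A.
Proof.
move=> mA; apply: (@smallest_sub _ (sigma_algebra setT) open _ _ _ A mA).
  exact: (@sigma_algebra_measurable _ (caratheodory_type content_outer)).
by move=> U; exact: open_caratheodory.
Qed.

Let content_measure_sigma_additive : semi_sigma_additive content_measure.
Proof.
move=> F mF tF mUF.
apply: (@caratheodory_measure_sigma_additive R Y content_outer) => //.
  by move=> n; exact: borel_cara.
exact: borel_cara.
Qed.

HB.instance Definition _ := @isMeasure.Build _ (borel Y) R content_measure
  outer0 outer_ge0 content_measure_sigma_additive.

Let content_measureT : content_measure setT = 1.
Proof.
by rewrite /content_measure content_outer_open ?inner_contentT//; exact: openT.
Qed.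

HB.instance Definition _ := @Measure_isProbability.Build _ (borel Y) R
  content_measure content_measureT.

Lemma closed_content_measure : exists mu : probability (borel Y) R,
  forall U : set Y, open U -> mu U = (inner_content U)%:E.
Proof. by exists content_measure => U oU; exact: content_outer_open. Qed.

End content_measure.

Lemma measurable_open (T : ptopologicalType) (U : set (borel T)) :
  open (U : set T) -> measurable U.
Proof. exact: sub_sigma_algebra. Qed.

Lemma measurable_closed (T : ptopologicalType) (K : set (borel T)) :
  closed (K : set T) -> measurable K.
Proof.
move=> clK; rewrite -[K]setCK; apply: measurableC; apply: measurable_open.
exact: closed_openC.
Qed.

Lemma fmap_ultrafilter (T U : Type) (g : T -> U) (G : set_system T) :
  UltraFilter G -> UltraFilter (g @ G).
Proof.
move=> GU; split=> [|H PH GH]; first exact: fmap_proper_filter.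
apply/seteqP; split=> // A HA.
have [//|nA] := in_ultra_setVsetC (g @^-1` A) GU.
have /GH HnA : (g @ G) (~` A) by [].
by exfalso; apply: (@filter_not_empty _ H _); rewrite -(setICr A); exact: filterI.
Qed.

Section closed_content_lemmas.
Context {R : realType}.

Lemma measure_closed_content {Y : ptopologicalType}
    (mu : probability (borel Y) R) :
  @closed_content R Y (fun A => fine (mu A)).
Proof.
have mC := @measurable_closed Y.
have fin (K : set (borel Y)) : measurable K -> mu K \is a fin_num.
  by move=> mK; exact: fin_num_measure.
split.
- move=> K L cK cL KL; apply: fine_le; [exact: fin (mC _ _)|exact: fin (mC _ _)|].
  by apply: le_measure; rewrite ?inE//; exact: mC.
- move=> K L cK cL; rewrite -fineD; [|exact: fin (mC _ _)..].
  apply: fine_le.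
  + by apply: fin; apply: mC; exact: closedU.
  + by rewrite fin_numD !fin//; exact: mC.
  + by apply: measureU2; exact: mC.
- move=> K L cK cL KL; rewrite -fineD; [|exact: fin (mC _ _)..].
  by rewrite (measureU mu (mC _ cK) (mC _ cL) KL).
- by rewrite probability_setT.
Qed.

Lemma closed_content_sum {Y : topologicalType} (I : finType) (p : I -> R)
    (m : I -> set Y -> R) :
  (forall i, 0 <= p i) -> \sum_i p i = 1 ->
  (forall i, closed_content (m i)) ->
  closed_content (fun A => \sum_i p i * m i A).
Proof.
move=> p0 p1 cm; split.
- move=> K L cK cL KL; apply: ler_sum => i _; apply: ler_wpM2l => //.
  exact: closed_content_le.
- move=> K L cK cL; rewrite -big_split/=; apply: ler_sum => i _.
  by rewrite -mulrDr; apply: ler_wpM2l => //; exact: closed_contentU.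
- move=> K L cK cL KL; rewrite -big_split/=; apply: eq_bigr => i _.
  by rewrite -mulrDr; congr *%R; exact: closed_content_disjoint.
- by rewrite -p1; apply: eq_bigr => i _; rewrite closed_contentT ?mulr1.
Qed.

Lemma closed_content_preimage {Y Z : topologicalType} (phi : Z -> Y)
    (m : set Z -> R) :
  continuous phi -> closed_content m -> closed_content (fun A => m (phi @^-1` A)).
Proof.
move=> cphi cm.
have cl K : closed K -> closed (phi @^-1` K).
  by apply: preimage_closed => x _; exact: cphi.
split.
- move=> K L /cl cK /cl cL KL; apply: closed_content_le => // x; exact: KL.
- by move=> K L /cl cK /cl cL; exact: closed_contentU.
- move=> K L /cl cK /cl cL KL; apply: closed_content_disjoint => //.
  by rewrite -preimage_setI KL preimage_set0.
- exact: closed_contentT.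
Qed.

Lemma ultrafilter_cvg (G : set_system nat) (u : nat -> R) (a b : R) :
  UltraFilter G -> (forall n, a <= u n <= b) -> cvg (u @ G).
Proof.
move=> GU uab.
have uF : (u @ G) `[a, b]%classic.
  apply: (@filterS _ G _ setT) => [n _ /=|]; last exact: filterT.
  by rewrite in_itv/=; exact: uab.
have := @segment_compact R a b; rewrite compact_ultra => /(_ (u @ G)).
by move=> /(_ (fmap_ultrafilter u GU) uF)[l [_ ul]]; apply/cvg_ex; exists l.
Qed.

(** An ultrafilter makes the values on all closed sets converge at once. It refines [\oo], so a
    value that is constant for large n is the limit. *)
Lemma closed_content_limit {Y : topologicalType} (m_ : nat -> set Y -> R) :
  (forall n, closed_content (m_ n)) ->
  exists (G : set_system nat) (m : set Y -> R),
    [/\ ProperFilter G, \oo `<=` G, closed_content m &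
        forall K, closed K -> m_ ^~ K @ G --> m K].
Proof.
move=> cm; have [G [GU ooG]] := @ultraFilterLemma nat \oo _.
exists G, (fun K => lim (m_ ^~ K @ G)).
have cvgm K : closed K -> m_ ^~ K @ G --> lim (m_ ^~ K @ G).
  move=> cK; apply: (@ultrafilter_cvg G _ 0 1) => // n.
  by rewrite (closed_content_ge0 (cm n))// (closed_content_le1 (cm n)).
split => //; first exact: ultra_proper.
split.
- move=> K L cK cL KL; apply: (ler_cvg_to (cvgm _ cK) (cvgm _ cL)).
  by apply: nearW => n; exact: (closed_content_le (cm n)).
- move=> K L cK cL.
  apply: (ler_cvg_to (cvgm _ (closedU cK cL)) (cvgD (cvgm _ cK) (cvgm _ cL))).
  by apply: nearW => n; exact: (closed_contentU (cm n)).
- move=> K L cK cL KL.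
  rewrite -(cvg_lim _ (cvgD (cvgm _ cK) (cvgm _ cL)))//.
  congr (lim (_ @ G)); apply/funext => n /=.
  exact: (closed_content_disjoint (cm n)).
- rewrite (_ : m_ ^~ setT = cst 1) ?lim_cst//.
  by apply/funext => n; exact: (closed_contentT (cm n)).
Qed.

End closed_content_lemmas.

(** * Stationary measures as limits of Cesaro means *)

Section mixture_invariance.
Context {R : realType} {Y : ptopologicalType} {I : finType}.
Variables (p : I -> R) (f : I -> Y -> Y).
Hypotheses (p0 : forall i, 0 <= p i) (p1 : \sum_i p i = 1).
Hypothesis cf : forall i, continuous (f i).

Lemma borel_measurable_continuous (T U : ptopologicalType) (g : T -> U) :
  continuous g -> measurable_fun setT (g : borel T -> borel U).
Proof.
move=> cg.
apply: (@measurability _ _ (borel T) (borel U) _ _ (@open U)) => // _ [B oB <-].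
by rewrite setTI; apply: measurable_open; apply: open_comp => // x _; exact: cg.
Qed.

Lemma borel_preimage (T U : ptopologicalType) (g : T -> U) (B : set (borel U)) :
  continuous g -> measurable B -> measurable (g @^-1` B : set (borel T)).
Proof.
move=> cg mB; rewrite -[X in measurable X]setTI.
exact: (borel_measurable_continuous cg).
Qed.

Lemma mixture_invariant_borel (tau : probability (borel Y) R) :
  (forall U : set Y, open U ->
     tau U = (\sum_i (p i)%:E * tau (f i @^-1` U))%E) ->
  forall B : set (borel Y), measurable B ->
     tau B = (\sum_i (p i)%:E * tau (f i @^-1` B))%E.
Proof.
move=> tauU; apply: (@dynkin_induction _ (borel Y) (@open Y)) => //.
- exact: openI.
- exact: tauU openT.
- move=> S mS tauS.
  have fpre i : tau (f i @^-1` S) \is a fin_num.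
    by rewrite fin_num_measure//; exact: borel_preimage.
  rewrite probability_setC// tauS.
  rewrite (eq_bigr (fun i => (p i * fine (tau (f i @^-1` S)))%:E)); last first.
    by move=> i _; rewrite EFinM fineK.
  rewrite [RHS](eq_bigr (fun i => (p i - p i * fine (tau (f i @^-1` S)))%:E)).
    by rewrite !sumEFin sumrB p1 EFinB.
  move=> i _; rewrite preimage_setC probability_setC; last exact: borel_preimage.
  by rewrite -(fineK (fpre i)) -EFinB -EFinM mulrBr mulr1.
- move=> F mF tF tauF; rewrite measure_bigcup// (@eq_eseriesl _ _ xpredT)//; last first.
    by move=> n; rewrite in_setT.
  rewrite (eq_eseriesr (fun n _ => tauF n)).
  rewrite nneseries_sum; last by move=> i n _; rewrite mule_ge0// lee_fin.
  apply: eq_bigr => i _; rewrite nneseriesZl//.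
  rewrite preimage_bigcup measure_bigcup//.
  + by congr *%E; apply: eq_eseriesl => n; rewrite in_setT.
  + by move=> n _; exact: borel_preimage.
  + by apply/trivIsetP => j k _ _ jk; rewrite -preimage_setI;
      move/trivIsetP : tF => -> //; rewrite preimage_set0.
Qed.

(** Krylov-Bogolyubov argument: Cesaro means of the iterates of the averaging operator [P] on a
    Dirac mass are almost invariant, so their limit content is invariant on closed sets. Passing to
    the measure, which is known on open sets, takes an approximation from inside. *)
Lemma exists_mixture_invariant :
  hausdorff_space Y -> compact [set: Y] ->
  exists tau : probability (borel Y) R, forall B : set (borel Y), measurable B ->
    tau B = (\sum_i (p i)%:E * tau (f i @^-1` B))%E.
Proof.
move=> hY cY.
have clf i K : closed K -> closed (f i @^-1` K).
  by apply: preimage_closed => x _; exact: cf.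
pose P (m : set Y -> R) (A : set Y) := \sum_i p i * m (f i @^-1` A).
have ccP m : closed_content m -> closed_content (P m).
  by move=> cm; apply: closed_content_sum => // i; exact: closed_content_preimage.
pose d (A : set Y) : R := fine (@dirac _ (borel Y) point R A).
have ccd n : closed_content (iter n P d).
  by elim: n => [|n]; [exact: measure_closed_content|exact: ccP].
pose c n (A : set Y) := \sum_(k < n.+1) n.+1%:R^-1 * iter k P d A.
have ccc n : closed_content (c n).
  apply: (@closed_content_sum _ _ _ (fun=> n.+1%:R^-1)
    (fun k : 'I_n.+1 => iter k P d)) => //.
  by rewrite sumr_const card_ord -[_^-1 *+ _]mulr_natr mulVf.
have [G [m [PG ooG cm cvgm]]] := closed_content_limit ccc.
have mP K : closed K -> m K = P m K.
  move=> cK.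
  have cvgP : (fun n => P (c n) K) @ G --> P m K.
    rewrite /P; apply: cvg_big; [exact: add_continuous|] => i _.
    by apply: cvgMl_tmp; apply: cvgm; exact: clf.
  (* The difference telescopes to (d K - P^(n+1) d K) / (n+1), of absolute value at most 1/(n+1). *)
  have cvg0 : (fun n => c n K - P (c n) K) @ G --> 0.
    have hG : harmonic @ G --> (0 : R).
      by apply: cvg_trans (cvg_harmonic); exact: cvg_app.
    apply: (@squeeze_cvgr _ _ _ _ (fun n => - harmonic n) harmonic _ _ 0) => //.
      apply: nearW => n.
      have -> : P (c n) K = \sum_(k < n.+1) n.+1%:R^-1 * iter k.+1 P d K.
        rewrite /P /c; under eq_bigr do rewrite mulr_sumr.
        rewrite exchange_big/=; apply: eq_bigr => k _.
        by rewrite mulr_sumr; apply: eq_bigr => i _; rewrite mulrCA.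
      rewrite /c -!mulr_sumr -mulrBr -ler_norml normrM ger0_norm// ler_piMr//.
      rewrite -sumrB -(big_mkord xpredT (fun k => iter k P d K - iter k.+1 P d K)).
      rewrite (@telescope_sumr_eq _ _ _ (fun k => - iter k P d K))//; last first.
        by move=> k _; rewrite opprK addrC.
      have := closed_content_ge0 (ccd n.+1) cK; have := closed_content_le1 (ccd n.+1) cK.
      have := closed_content_ge0 (ccd 0) cK; have := closed_content_le1 (ccd 0) cK.
      by rewrite ler_norml; lra.
    by rewrite -[X in _ --> X]oppr0; exact: cvgN.
  apply/eqP; rewrite -subr_eq0; apply/eqP.
  rewrite -(cvg_lim _ cvg0)//; apply/esym/cvg_lim => //.
  by apply: cvgB; [exact: cvgm|exact: cvgP].
have [tau htau] := closed_content_measure hY cY cm.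
exists tau; apply: mixture_invariant_borel => U oU.
have oUi i : open (f i @^-1` U) by apply: open_comp => // x _; exact: cf.
rewrite htau// (eq_bigr (fun i => (p i * inner_content m (f i @^-1` U))%:E)); last first.
  by move=> i _; rewrite htau// EFinM.
rewrite sumEFin; congr (_%:E); apply/eqP; rewrite eq_le; apply/andP; split.
  apply: (inner_content_le_ub cm) => K cK KU; rewrite mP//; apply: ler_sum => i _.
  apply: ler_wpM2l => //; apply: (inner_content_ub cm); first exact: clf.
  by move=> x; exact: KU.
(* Conversely, near-optimal closed sets [K i] in the preimages of [U] are pushed forward: the union
   [L] of their images is closed by compactness, lies in [U], and its preimage by [f i] contains
   [K i]. *)
apply/ler_addgt0Pl => e e0.
have /choice[K hK] i : exists K, [/\ closed K, K `<=` f i @^-1` U &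
    inner_content m (f i @^-1` U) - e < m K].
  have [_ [K [cK KU] <-] h] := sup_adherent e0 (inner_content_has_sup cm (f i @^-1` U)).
  by exists K.
pose L := \bigcup_i (f i @` K i).
have cL : closed L.
  apply: closed_bigcup; first exact: finite_finset.
  move=> i _; have [cK _ _] := hK i.
  apply: compact_closed => //; apply: continuous_compact.
    exact: continuous_subspaceT.
  exact: subclosed_compact cK cY _.
have LU : L `<=` U.
  by move=> _ [i _ [x Kx <-]]; have [_ KU _] := hK i; exact: KU.
apply: le_trans (_ : e + m L <= _); last first.
  by rewrite lerD2l; exact: (inner_content_ub cm).
rewrite mP// -[e]mulr1 -p1 mulr_sumr -big_split/=; apply: ler_sum => i _.
rewrite [e * _]mulrC -mulrDr; apply: ler_wpM2l => //.
have [cK KU mK] := hK i.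
rewrite -lerBlDl; apply: le_trans (ltW mK) _.
apply: (closed_content_le cm) => //; first exact: clf.
by move=> x Kx; exists i => //; exists x.
Qed.

End mixture_invariance.

(** * Topology and Borel sets of the shift space *)

Lemma hausdorff_prod (T U : topologicalType) :
  hausdorff_space T -> hausdorff_space U -> hausdorff_space (T * U)%type.
Proof.
move=> hT hU [p1 p2] [q1 q2] pq; congr pair.
  apply: hT => A B Ap Bq.
  have [] := pq (A `*` setT) (B `*` setT).
  - by exists (A, setT) => //; split => //; exact: filterT.
  - by exists (B, setT) => //; split => //; exact: filterT.
  by move=> [x y] [[Ax _] [Bx _]]; exists x.
apply: hU => A B Ap Bq.
have [] := pq (setT `*` A) (setT `*` B).
- by exists (setT, A) => //; split => //; exact: filterT.
- by exists (setT, B) => //; split => //; exact: filterT.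
by move=> [x y] [[_ Ay] [_ By]]; exists y.
Qed.

Lemma snd_continuous (T U : topologicalType) : continuous (@snd T U).
Proof. by move=> x; exact: cvg_snd. Qed.

Lemma open_setX (T U : topologicalType) (A : set T) (B : set U) :
  open A -> open B -> open (A `*` B).
Proof.
rewrite !openE => oA oB [x y] [/= Ax By]; exists (A, B) => //=.
by split; [exact: oA|exact: oB].
Qed.

Lemma continuous_ptws (T : topologicalType) (I : eqType) (V : topologicalType)
    (g : T -> {ptws I -> V}) :
  (forall i, continuous (fun x => g x i)) -> continuous g.
Proof.
move=> cg x; apply/cvg_sup => i.
rewrite cvg_image; last by rewrite eqEsubset; split=> v // _; exists (cst v).
move=> W /= /(cg i x) gW; exists (@^~ i @^-1` W) => //.
by rewrite eqEsubset; split => [j [? + <-//]|j Wj]; exists (fun _ => j).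
Qed.

Section shift_topology.
Variable S : markov_shift.
Notation Sigma := (shift_space S).
Notation A := (alphabet S).

Lemma symbol_inj (w w' : Sigma) : (forall i, symbol w i = symbol w' i) -> w = w'.
Proof. by move=> ww'; apply: val_inj; apply/funext => i; exact: ww'. Qed.

Lemma symbol_continuous (i : int) :
  continuous (fun w : Sigma => symbol w i : discrete_topology A).
Proof.
move=> w.
have c : {for w, continuous (val : Sigma -> {ptws int -> discrete_topology A})}.
  exact: (@initial_continuous (set_type (@admissible S)) _ set_val).
exact: (continuous_comp c (@proj_continuous int (fun=> discrete_topology A) i _)).
Qed.

Lemma symbol_clopen (i : int) (P : set A) : clopen [set w : Sigma | P (symbol w i)].
Proof.
have c := @symbol_continuous i.
split.
  apply: (@open_comp _ _ (fun w : Sigma => symbol w i : discrete_topology A) P).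
    by move=> w _; exact: c.
  exact: discrete_open.
apply: (@preimage_closed _ _ (fun w : Sigma => symbol w i : discrete_topology A) P).
  by move=> w _; exact: c.
exact: discrete_closed.
Qed.

Lemma shift_space_hausdorff : hausdorff_space Sigma.
Proof.
rewrite open_hausdorff => w w' ww'.
have [i wi] : exists i, symbol w i <> symbol w' i.
  apply: contrapT => /forallNP h; move/eqP : ww'; apply; apply: symbol_inj => i.
  by have := h i => /contrapT.
exists ([set v | symbol v i = symbol w i], [set v | symbol v i = symbol w' i]).
  by split; rewrite inE.
split; [exact: (symbol_clopen i (fun a => a = symbol w i)).1|
        exact: (symbol_clopen i (fun a => a = symbol w' i)).1|].
by apply/eqP; rewrite -subset0 => v [/= -> /wi].
Qed.

Lemma admissible_closed : closed (@admissible S).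
Proof.
rewrite (_ : admissible (m := S) = \bigcap_(i : int)
   [set w | allowed (w i : A) (w (i + 1) : A)]); last first.
  by apply/seteqP; split => w aw i; [move=> _; exact: aw|exact: (aw i I)].
apply: closed_bigI => i _.
rewrite (_ : [set w | _] = \bigcup_(ab in [set ab : A * A | allowed ab.1 ab.2])
   ((fun w : {ptws int -> discrete_topology A} => w i) @^-1` [set ab.1] `&`
    (fun w : {ptws int -> discrete_topology A} => w (i + 1)) @^-1` [set ab.2]));
  last first.
  apply/seteqP; split => [w aw|w [[a b] /= ab [wa wb]]].
    by exists (w i, w (i + 1)).
  by rewrite wa wb.
apply: closed_bigcup; first exact: finite_finset.
move=> [a b] _; apply: closedI; apply: preimage_closed; try exact: discrete_closed.
  by move=> w _; exact: (@proj_continuous int (fun=> discrete_topology A) i).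
by move=> w _; exact: (@proj_continuous int (fun=> discrete_topology A) (i + 1)).
Qed.

Lemma shift_space_compact : compact [set: Sigma].
Proof.
rewrite compact_ultra => G GU _.
have cA : compact (@admissible S).
  have cT := @tychonoff int (fun=> discrete_topology A) (fun=> setT)
    (fun _ => @finite_compact (discrete_topology A) _ (@finite_finset A setT)).
  apply: (subclosed_compact admissible_closed cT) => w _ i //.
have := cA; rewrite compact_ultra => /(_ _ (fmap_ultrafilter val GU)).
case.
  by apply: (@filterS _ G _ setT) => [w _|]; [exact: set_mem (valP w)|exact: filterT].
move=> w [aw Gw]; exists (SigSub (mem_set aw)); split => // B.
rewrite nbhsE/= => -[_ [[C oC <-] Cw] CB].
apply: (@filterS _ G _ (set_val @^-1` C)) => //.
by apply: Gw; apply: open_nbhs_nbhs.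
Qed.

(** The window is -m, ..., -1 and 0, ..., k-1, as [Negz i] is -(i+1). The two lengths are separate
    because preimages by the shift trade a past symbol for a future one, and the quotient by [past]
    forgets the future. *)
Definition two_sided_cylinder (m k : nat) (u : int -> A) : set Sigma :=
  [set w | (forall i : nat, (i < m)%N -> symbol w (Negz i) = u (Negz i)) /\
           (forall i : nat, (i < k)%N -> symbol w (Posz i) = u (Posz i))].

Local Notation cyl := two_sided_cylinder.

Lemma two_sided_cylinder_symbol m k u (w : Sigma) :
  cyl m k u w -> cyl m k u = cyl m k (symbol w).
Proof.
move=> [um uk]; apply/seteqP; split => v [vm vk]; split => i im;
  by rewrite ?vm ?vk ?um ?uk.
Qed.

Lemma two_sided_cylinder_clopen m k u : clopen (cyl m k u).
Proof.
have -> : cyl m k u =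
    (\bigcap_(i in `I_m) [set w | symbol w (Negz i) = u (Negz i)]) `&`
    (\bigcap_(i in `I_k) [set w | symbol w (Posz i) = u (Posz i)]).
  by apply/seteqP; split => w [].
have cl (v : nat -> int) n :
    clopen (\bigcap_(i in `I_n) [set w : Sigma | symbol w (v i) = u (v i)]).
  elim: n => [|n IHn].
    by rewrite II0 bigcap_set0; exact: clopenT.
  rewrite IIS bigcap_setU bigcap_set1; apply: clopenI => //.
  exact: (symbol_clopen (v n) (fun a => a = u (v n))).
by apply: clopenI; exact: cl.
Qed.

(** The complements of the cylinders around [w] cover the compact complement of [O]; the cylinders
    are nested, so a single one already avoids it. *)
Lemma two_sided_cylinder_base (w : Sigma) (O : set Sigma) : open O -> O w ->
  exists n, cyl n n (symbol w) `<=` O.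
Proof.
move=> oO Ow.
have cO : compact (~` O).
  apply: (subclosed_compact _ shift_space_compact) => //; exact: open_closedC.
move: cO; rewrite compact_cover => /(_ _ setT (fun n => ~` cyl n n (symbol w))).
case.
- by move=> n _; apply: closed_openC; exact: (two_sided_cylinder_clopen _ _ _).2.
- move=> v nOv; apply: contrapT => nv; apply: nOv.
  suff -> : v = w by [].
  apply: symbol_inj => -[] i; apply: contrapT => vi; apply: nv; exists i.+1 => //.
    by move=> [_ /(_ i (ltnSn _))].
  by move=> [/(_ i (ltnSn _))].
move=> D _ OD; exists (\max_(i <- finmap.enum_fset D) i) => v [vn vp].
apply: contrapT => nO; have [i iD] := OD v nO; apply.
have iM : (i <= \max_(i <- finmap.enum_fset D) i)%N.
  by apply: (@leq_bigmax_seq _ _ xpredT id).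
by split=> j ji; [apply: vn|apply: vp]; exact: leq_trans ji iM.
Qed.


Lemma continuous_initial (T V : topologicalType) (B : set V) (g : T -> set_type B) :
  continuous (fun x => set_val (g x)) -> continuous g.
Proof.
move=> cg x N; rewrite nbhsE/= => -[_ [[C oC <-] Cx] CN].
apply: filterS CN _; exact: (cg x C (open_nbhs_nbhs _)).
Qed.

Lemma continuous_shift : continuous (@shift S).
Proof.
apply: (@continuous_initial _ _ (@admissible S) (@shift S)).
apply: (@continuous_ptws _ _ (discrete_topology A)) => i.
exact: (@symbol_continuous (i + 1)).
Qed.

Lemma continuous_past : continuous (@past S).
Proof.
apply: (@continuous_initial _ _ (range (@past_seq S)) (@past S)).
apply: (@continuous_ptws _ _ (discrete_topology A)) => i.
exact: (@symbol_continuous (Negz i)).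
Qed.

Definition past_symbol (p : past_space S) (n : nat) : A := val p n.

Lemma past_symbolE w n : past_symbol (past w) n = symbol w (Negz n).
Proof. by []. Qed.

Lemma past_symbol_continuous (n : nat) :
  continuous (fun p : past_space S => past_symbol p n : discrete_topology A).
Proof.
move=> p.
have c : {for p, continuous (val : past_space S -> {ptws nat -> discrete_topology A})}.
  exact: (@initial_continuous (set_type (range (@past_seq S))) _ set_val).
exact: (continuous_comp c (@proj_continuous nat (fun=> discrete_topology A) n _)).
Qed.

Lemma past_symbol_clopen (n : nat) (P : set A) :
  clopen [set p : past_space S | P (past_symbol p n)].
Proof.
have c := @past_symbol_continuous n.
split.
  apply: (@open_comp _ _ (fun p => past_symbol p n : discrete_topology A) P).
    by move=> w _; exact: c.
  exact: discrete_open.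
apply: (@preimage_closed _ _ (fun p => past_symbol p n : discrete_topology A) P).
  by move=> w _; exact: c.
exact: discrete_closed.
Qed.

End shift_topology.
Notation cyl := two_sided_cylinder.

(** * Boxes generating the Borel sets of the phase space *)

Section phase_borel.
Context {R : realType} {S : markov_shift} {X : pmetricType R}.
Notation Sigma := (shift_space S).
Notation A := (alphabet S).
Notation phase := (borel (Sigma * X)%type).

Definition cylinder_boxes : set (set phase) :=
  [set B | exists (n : nat) (u : int -> A) (U : set X), open U /\ B = cyl n n u `*` U].

(** Two cylinders that meet are cylinders around a common point, and the longer one is their
    intersection. *)
Lemma cylinder_boxesI : setI_closed cylinder_boxes.
Proof.
move=> _ _ [n [u [U [oU ->]]]] [m [v [V [oV ->]]]].
rewrite /cylinder_boxes/= -setXI.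
have [uv0|/set0P[w [uw vw]]] := eqVneq (cyl n n u `&` cyl m m v) set0.
  by exists n, u, set0; split; [exact: open0|rewrite uv0 set0X setX0].
exists (maxn n m), (symbol w), (U `&` V); split; first exact: openI.
congr (_ `*` _).
rewrite (two_sided_cylinder_symbol uw) (two_sided_cylinder_symbol vw).
apply/seteqP; split => x.
  move=> [[xn xn'] [xm xm']]; split => i; rewrite leq_max => /orP[] h; move: i h;
  [exact: xn|exact: xm|exact: xn'|exact: xm'].
move=> [xm xm']; split; split => i h; rewrite ?xm ?xm'// leq_max h ?orbT//.
Qed.

Lemma open_cylinder_box m k u (U : set X) : open U ->
  open (cyl m k u `*` U : set (Sigma * X)).
Proof.
by move=> oU; apply: open_setX => //; exact: (two_sided_cylinder_clopen _ _ _).1.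
Qed.

Let word (s : seq A) (i : nat) : A := nth (symbol point 0) s i.

(* An open set O is the union over the countably many cylinders C of C x U_C,
   where U_C is the union of the open U such that C x U is included in O. *)
Lemma open_cylinder_boxes (O : set (Sigma * X)) : open O -> <<s cylinder_boxes >> O.
Proof.
move=> oO.
pose u (st : seq A * seq A) (i : int) : A :=
  match i with Posz i => word st.2 i | Negz i => word st.1 i end.
pose U n (st : seq A * seq A) : set X :=
  \bigcup_(V in [set V : set X | open V /\ cyl n n (u st) `*` V `<=` O]) V.
pose B (k : nat) : set (Sigma * X) :=
  if (unpickle k : option (nat * (seq A * seq A))) is Some (n, st)
  then cyl n n (u st) `*` U n st else set0.
have -> : O = \bigcup_k B k.
  apply/seteqP; split => [[w t] Owt|[w t] [k _]]; last first.
    rewrite /B; case: unpickle => // -[n st] [/= uw [V [oV VO] Vt]].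
    exact: (VO (w, t)).
  have : nbhs (w, t) O by exact: open_nbhs_nbhs.
  move=> [[/= P Q] [wP tQ] PQ].
  move: wP; rewrite nbhsE => -[P' [oP' P'w] P'P].
  move: tQ; rewrite nbhsE => -[Q' [oQ' Q't] Q'Q].
  have [n nP] := two_sided_cylinder_base oP' P'w.
  pose st := (mkseq (fun i => symbol w (Negz i)) n, mkseq (fun i => symbol w (Posz i)) n).
  exists (pickle (n, st)) => //; rewrite /B pickleK.
  have st1 i : (i < n)%N -> u st (Negz i) = symbol w (Negz i).
    by move=> i_n; rewrite /u /word nth_mkseq.
  have st2 i : (i < n)%N -> u st (Posz i) = symbol w (Posz i).
    by move=> i_n; rewrite /u /word nth_mkseq.
  split => /=; first by split => i i_n; rewrite ?st1 ?st2.
  exists Q' => //; split => // -[v s] [/= [vn vp] Q's].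
  apply: PQ; split; [apply: P'P; apply: nP|exact: Q'Q].
  by split => i i_n; rewrite ?vn ?vp ?st1 ?st2.
have := @sigma_algebra_bigcup _ setT cylinder_boxes.
apply => k; rewrite /B; case: unpickle => [[n st]|]; last exact: sigma_algebra0.
apply: sub_gen_smallest; exists n, (u st), (U n st); split => //.
by apply: bigcup_open => V [].
Qed.

Lemma phase_measurableE : @measurable _ phase = <<s cylinder_boxes >>.
Proof.
apply/seteqP; split => B mB.
  apply: (smallest_sub _ _ mB); first exact: smallest_sigma_algebra.
  exact: open_cylinder_boxes.
apply: (smallest_sub _ _ mB); first exact: smallest_sigma_algebra.
move=> _ [n [u [U [oU ->]]]]; apply: sub_gen_smallest.
exact: open_cylinder_box.
Qed.

Lemma eq_phase_measure (mu nu : probability phase R) :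
  (forall n u (U : set X), open U ->
    mu (cyl n n u `*` U) = nu (cyl n n u `*` U)) ->
  forall B : set phase, measurable B -> mu B = nu B.
Proof.
move=> munu B mB.
apply: (measure_unique cylinder_boxes (fun=> setT)) => //.
- exact: phase_measurableE.
- exact: cylinder_boxesI.
- move=> _; exists 0%N, (fun=> symbol point 0), setT; split; first exact: openT.
  by apply/seteqP; split => // -[w t].
- by rewrite bigcup_const.
- by move=> _ [n [u [U [oU ->]]]]; exact: munu.
- by move=> _; rewrite -ge0_fin_numE// fin_num_measure.
Qed.

End phase_borel.

(** * Bernoulli futures *)

Lemma NegzS_add1 (i : nat) : Negz i.+1 + 1 = Negz i.
Proof. by rewrite !NegzE -[i.+2]addn1 PoszD opprD addrNK. Qed.

Lemma continuous_pairl (T U : topologicalType) (x : T) :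
  continuous (fun t : U => (x, t)).
Proof.
move=> t B [[P Q] [/= Px Qt] PQ]; apply: filterS Qt => s Qs; apply: PQ.
by split => //; exact: nbhs_singleton.
Qed.

Lemma pushforward_probability (R : realType) (T U : ptopologicalType) (g : T -> U)
    (mu : probability (borel T) R) : continuous g ->
  exists nu : probability (borel U) R,
    nu = pushforward (T2 := borel U) mu g :> (set (borel U) -> \bar R).
Proof.
move=> cg; have mg := borel_measurable_continuous cg.
pose h : {mfun (borel T) >-> (borel U)} :=
  HB.pack (g : borel T -> borel U) (isMeasurableFun.Build _ _ _ _ _ mg).
by exists (distribution mu h).
Qed.

(** The points at distance at least 1/(n+1) from the complement of [U] form closed sets increasing
    to [U]. *)
Lemma open_inner_regular (R : realType) (X : pmetricType R)
    (tau : probability (borel X) R) (U : set X) (e : R) : open U -> 0 < e ->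
  exists K, [/\ closed K, K `<=` U & fine (tau U) - e < fine (tau K)].
Proof.
move=> oU e0.
pose K n := [set x : X | ball x (n.+1%:R^-1) `<=` U].
have cK n : closed (K n).
  rewrite -[K n]setCK; apply: open_closedC; rewrite openE => x xK.
  have [y [xy nUy]] : exists y, ball x (n.+1%:R^-1) y /\ ~ U y.
    apply: contrapT => h; apply: xK => y xy; apply: contrapT => nUy.
    by apply: h; exists y.
  have d0 : 0 < n.+1%:R^-1 - mdist x y by rewrite subr_gt0; move: xy; rewrite ballEmdist.
  apply/nbhs_ballP; exists (n.+1%:R^-1 - mdist x y) => //= z xz zK.
  apply: nUy; apply: zK; rewrite ballEmdist/=.
  apply: le_lt_trans (metric_triangle z x y) _.
  by move: xz; rewrite ballEmdist/= metric_sym ltrBrDr.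
have UE : U = \bigcup_n K n.
  apply/seteqP; split=> [x Ux|x [n _ xK]]; last by apply: xK; exact: ballxx.
  have /nbhs_ballP[d /= d0 dU] : nbhs x U by exact: open_nbhs_nbhs.
  have [n nd] := @ltr_add_invr R 0 d d0; rewrite add0r in nd.
  exists n => // y xy; apply: dU; apply: le_ball xy; exact: ltW.
have mK n : measurable (K n : set (borel X)) by exact: measurable_closed.
have ndK : nondecreasing_seq K.
  apply/nondecreasing_seqP => n; apply/subsetPset => x xK y xy; apply: xK.
  by apply: le_ball xy; rewrite lef_pV2 ?posrE// ler_nat.
have mU : measurable (U : set (borel X)) by exact: measurable_open.
have /fine_cvgP[_] : tau \o K @ \oo --> (fine (tau U))%:E.
  rewrite fineK ?fin_num_measure// UE.
  by apply: (@nondecreasing_cvg_mu _ (borel X)) => //; rewrite -UE.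
move=> /cvgrPdist_lt /(_ e e0) [n _ /(_ n (leqnn n))/=].
move=> h; exists (K n); split => //; first by rewrite UE; exact: bigcup_sup.
by move: h; rewrite ltr_norml => /andP[_]; lra.
Qed.

Section box_limit.
Context {R : realType} {S : markov_shift} {X : pmetricType R}.
Notation Sigma := (shift_space S).
Notation phase := (borel (Sigma * X)%type).
Hypothesis cX : compact [set: X].

Lemma phase_compact : compact [set: (Sigma * X)%type].
Proof. by rewrite -setXTT; apply: compact_setX => //; exact: shift_space_compact. Qed.

Lemma phase_hausdorff : hausdorff_space (Sigma * X)%type.
Proof.
apply: hausdorff_prod; [exact: shift_space_hausdorff|exact: metric_hausdorff].
Qed.

(** The contents stabilise on closed sets, whereas the limit measure is known on open ones. Over a
    clopen [C] the two are reconciled by projecting compact sets to X on one side and by inner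
    regularity of [tau] on the other. *)
Lemma box_limit (m_ : nat -> set (Sigma * X) -> R) :
  (forall n, closed_content (m_ n)) ->
  exists mu : probability phase R,
    forall (C : set Sigma) (c : R) (tau : probability (borel X) R),
    clopen C -> 0 <= c ->
    (\forall n \near \oo, forall K, closed K -> m_ n (C `*` K) = c * fine (tau K)) ->
    forall U : set X, open U -> mu (C `*` U) = (c * fine (tau U))%:E.
Proof.
move=> cm; have [G [m [PG ooG cmm cvgm]]] := closed_content_limit cm.
have [mu hmu] := closed_content_measure phase_hausdorff phase_compact cmm.
exists mu => C c tau [oC clC] c0 hC U oU.
have clX (K : set X) : closed K -> closed (C `*` K).
  move=> clK; rewrite [_ `*` _](_ : _ = (fst @^-1` C) `&` (snd @^-1` K))//.
  by apply: closedI; apply: preimage_closed => // x _; [exact: cvg_fst|exact: cvg_snd].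
have mE (K : set X) : closed K -> m (C `*` K) = c * fine (tau K).
  move=> clK; rewrite -(cvg_lim _ (cvgm _ (clX _ clK)))//; apply/cvg_lim => //.
  apply: cvg_near_cst; apply: ooG.
  by apply: filterS hC => n /(_ _ clK).
have mtau := @measurable_closed X.
rewrite hmu; last exact: open_setX.
congr (_%:E); apply/eqP; rewrite eq_le; apply/andP; split.
  apply: (inner_content_le_ub cmm) => K clK KCU.
  have clL : closed (snd @` K).
    apply: compact_closed; first exact: metric_hausdorff.
    apply: continuous_compact.
      exact/continuous_subspaceT/snd_continuous.
    exact: subclosed_compact clK phase_compact _.
  have LU : snd @` K `<=` U by move=> _ [x /KCU[_ ?] <-].
  apply: (@le_trans _ _ (m (C `*` (snd @` K)))).
    apply: (closed_content_le cmm) => //; first exact: clX.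
    by move=> x Kx; split; [exact: (KCU _ Kx).1|exists x].
  rewrite mE//; apply: ler_wpM2l => //; apply: fine_le.
  - by rewrite fin_num_measure//; exact: mtau.
  - by rewrite fin_num_measure//; exact: measurable_open.
  - by apply: le_measure => //; rewrite inE; [exact: mtau|exact: measurable_open].
apply/ler_addgt0Pr => e e0.
(* Dividing by c + 1 covers c = 0 and still keeps c e / (c + 1) at most e. *)
have e1 : 0 < e / (c + 1) by rewrite divr_gt0// ltr_wpDl.
have [K [clK KU hK]] := open_inner_regular tau oU e1.
apply: (@le_trans _ _ (c * fine (tau K) + e)).
  have h : c * (e / (c + 1)) <= e.
    by rewrite mulrCA ler_piMr ?(ltW e0)// ler_pdivrMr ?mul1r ?ltr_wpDl// lerDl.
  have := ler_wpM2l c0 (ltW hK); rewrite mulrBr; lra.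
rewrite lerD2r -mE//; apply: (inner_content_ub cmm); first exact: clX.
by move=> [w t] [Cw Kt]; split => //; exact: KU.
Qed.

End box_limit.

Section bernoulli_extension.
Context {R : realType} {S : markov_shift} {X : pmetricType R}.
Notation Sigma := (shift_space S).
Notation A := (alphabet S).
Notation phase := (borel (Sigma * X)%type).
Hypothesis cX : compact [set: X].
Variables (nu0 : A -> R) (nu0_prob : cylinder_probability nu0)
  (nu0_adm : bernoulli_admissible nu0).

Lemma exists_positive_symbol : exists a, 0 < nu0 a.
Proof.
apply: contrapT => /forallNP h; have [n0 n1] := nu0_prob.
have : (0 : R) = 1.
  rewrite -n1 big1// => a _; apply/eqP; rewrite eq_le n0 andbT leNgt.
  by apply/negP; exact: h.
by move/eqP; rewrite eq_sym oner_eq0.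
Qed.

(** [xget] falls back on [point] when no admissible point has this past and this word. By the next
    lemma this requires a symbol of mass 0 in the word or at index -1 of [w]. *)
Definition future_extension (w : Sigma) (N : nat) (u : {ffun 'I_N -> A}) : Sigma :=
  xget point [set v | (forall i, symbol v (Negz i) = symbol w (Negz i)) /\
                      (forall j : 'I_N, symbol v (Posz j) = u j)].

Lemma future_extensionP w N (u : {ffun 'I_N -> A}) :
  0 < nu0 (symbol w (Negz 0)) -> (forall j, 0 < nu0 (u j)) ->
  (forall i, symbol (future_extension w u) (Negz i) = symbol w (Negz i)) /\
  (forall j : 'I_N, symbol (future_extension w u) (Posz j) = u j).
Proof.
move=> w0 u0; rewrite /future_extension; set Q := [set v | _].
apply: (xgetPex point (P := Q)).
have [a a0] := exists_positive_symbol.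
(* After the word a symbol [a] of positive mass is repeated for ever. From index -1 on, all
   transitions join symbols of positive mass and are allowed by [nu0_adm]. *)
pose g (i : int) : A :=
  match i with Negz _ => symbol w i | Posz i => if insub i is Some j then u j else a end.
have gpos i : 0 < nu0 (g (Posz i)) by rewrite /g; case: insub.
have ag : @admissible S g.
  move=> [i|[|i]].
  - by rewrite -PoszD; apply: nu0_adm; exact: gpos.
  - by apply: nu0_adm => //; exact: (gpos 0%N).
  - by rewrite NegzS_add1 /g -[in X in allowed _ X](NegzS_add1 i); exact: symbol_allowed.
exists (SigSub (mem_set ag)); split => // j.
by rewrite /symbol SubK /g valK.
Qed.

Lemma sum_word_prod (N : nat) (F : 'I_N -> A -> R) :
  \sum_(u : {ffun 'I_N -> A}) \prod_(j < N) F j (u j) = \prod_(j < N) \sum_a F j a.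
Proof. by rewrite bigA_distr_bigA. Qed.

(** The past of [w] is frozen, the future is i.i.d. of law [nu0], and the fibre point is independent
    of it with law [tau]. The approximation [m_ N] draws only N future symbols; it gives a box its
    final mass as soon as N >= k. *)
Lemma bernoulli_extension (w : Sigma) (tau : probability (borel X) R) :
  0 < nu0 (symbol w (Negz 0)) ->
  exists mu : probability phase R, forall m k (v : int -> A) (U : set X), open U ->
    mu (cyl m k v `*` U) =
    (`[< forall i, (i < m)%N -> symbol w (Negz i) = v (Negz i) >]%:R *
     \prod_(i < k) nu0 (v (Posz i)) * fine (tau U))%:E.
Proof.
move=> w0; have [n0 n1] := nu0_prob.
pose p N (u : {ffun 'I_N -> A}) := \prod_(j < N) nu0 (u j).
have p0 N u : 0 <= p N u by exact: prodr_ge0.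
have p1 N : \sum_u p N u = 1.
  by rewrite (sum_word_prod (fun _ => nu0)) big1.
pose m_ N (B : set (Sigma * X)) :=
  \sum_u p N u * fine (tau ((fun t => (future_extension w u, t)) @^-1` B)).
have cm N : closed_content (m_ N).
  apply: (@closed_content_sum _ _ _ (p N) (fun u B =>
    fine (tau ((fun t => (future_extension w u, t)) @^-1` B)))) => // u.
  apply: (@closed_content_preimage _ _ _ (fun t => (future_extension w u, t))
    (fun B => fine (tau B))).
    exact: continuous_pairl.
  exact: measure_closed_content.
have [mu hmu] := box_limit cX cm; exists mu => m k v U oU.
apply: hmu => //; first exact: two_sided_cylinder_clopen.
  by rewrite mulr_ge0// prodr_ge0.
exists k => // N /= kN K clK.
(* The constraints u_j = v_j for j < k are absorbed into the factors, so that the sum over words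
   becomes a product of sums, equal to nu0 of v_j for j < k and to 1 otherwise. *)
pose F (j : 'I_N) a : R := nu0 a * ((j < k)%N ==> (a == v (Posz j)))%:R.
set b := `[< _ >].
transitivity (\sum_(u : {ffun 'I_N -> A}) \prod_j F j (u j) * b%:R * fine (tau K)).
  apply: eq_bigr => u _.
  (* Words of weight 0, the only ones whose extension may be the fallback point, contribute 0 to
     both sides. *)
  have [/existsP[j uj]|/existsPn upos] := boolP [exists j, nu0 (u j) == 0].
    rewrite /p (bigD1 j)//= (eqP uj) !mul0r.
    by rewrite (bigD1 j)//= /F (eqP uj) !mul0r.
  have up j : 0 < nu0 (u j) by rewrite lt_neqAle eq_sym upos n0.
  have [extN extP] := future_extensionP w0 up.
  rewrite -mulrA; under [X in _ = X * _]eq_bigr do rewrite /F.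
  rewrite big_split/= -/(p N u) -mulrA; congr *%R.
  have [ub|nub] := boolP [forall j : 'I_N, (j < k)%N ==> (u j == v (Posz j))].
    rewrite big1 ?mul1r; last by move=> j _; rewrite (forallP ub j).
    rewrite /b; case: asboolP => [wv|nwv]; rewrite ?mul1r ?mul0r.
      congr (fine (tau _)); apply/seteqP; split=> [t []//|t Kt]; split => //.
      split=> i im /=; first by rewrite extN wv.
      have iN := leq_trans im kN.
      have := forallP ub (Ordinal iN); rewrite im => /eqP <-.
      by rewrite -(extP (Ordinal iN)).
    rewrite (_ : _ @^-1` _ = set0) ?measure0//.
    apply/seteqP; split=> // t [[/= h _] _]; apply: nwv => i im.
    by rewrite -extN h.
  have [j] := forallPn nub; rewrite negb_imply => /andP[jk uj].
  rewrite (bigD1 j)//= jk (negbTE uj) /= !mul0r.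
  rewrite (_ : _ @^-1` _ = set0) ?measure0//.
  apply/seteqP; split=> // t [[/= _ h] _]; move/eqP : uj; apply.
  by rewrite -extP h.
rewrite -mulr_suml -mulr_suml sum_word_prod [_ * b%:R]mulrC; congr (_ * _ * _).
rewrite (big_ord_widen N (fun i => nu0 (v (Posz i))) kN) [RHS]big_mkcond/=.
apply: eq_bigr => j _; rewrite /F; case: ifPn => jk; last first.
  by rewrite -[RHS]n1; apply: eq_bigr => a _; rewrite mulr1.
rewrite (bigD1 (v (Posz j)))//= eqxx mulr1 big1 ?addr0// => a.
by move=> /negbTE ->; rewrite mulr0.
Qed.

End bernoulli_extension.

(** * Skew products *)

Lemma measure_bigcup_fintype d (T : measurableType d) (R : realType)
    (mu : {measure set T -> \bar R}) (I : finType) (B : I -> set T) :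
  (forall i, measurable (B i)) -> trivIset setT B ->
  mu (\bigcup_i B i) = (\sum_i mu (B i))%E.
Proof.
move=> mB tB; rewrite measure_fin_bigcup//; last exact: finite_finset.
rewrite [RHS]fsbig_seq; last exact: index_enum_uniq.
rewrite (_ : [set` index_enum I] = setT)//.
by apply/seteqP; split => i //= _; rewrite mem_index_enum.
Qed.

Section kernel_integral.
Local Open Scope ereal_scope.
Context d1 d2 (T1 : measurableType d1) (T2 : measurableType d2) (R : realType).
Variables (theta : probability T1 R) (k : R.-pker T1 ~> T2).

Let kf (y : T1) : set T2 -> \bar R := k y.

HB.instance Definition _ y := isMeasure.Build _ _ _ (kf y)
  (measure0 (k y)) (measure_ge0 (k y)) (@measure_semi_sigma_additive _ _ _ (k y)).

HB.instance Definition _ y :=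
  Measure_isProbability.Build _ _ _ (kf y) (prob_kernel y : kf y setT = 1).

Lemma kernel_probability y : exists mu : probability T2 R,
  mu = k y :> (set T2 -> \bar R).
Proof. by exists (kf y). Qed.

Let kg (y : T1) : giry T2 R := kf y.

Let mkg : measurable_fun [set: T1] kg.
Proof.
by apply: measurable_giry_codensity => // B mB; exact: measurable_kernel.
Qed.

Definition kernel_mixture : giry T2 R := giry_bind (theta : giry T1 R) mkg.

Lemma kernel_mixtureE A : measurable A -> kernel_mixture A = \int[theta]_y k y A.
Proof.
move=> mA; rewrite /kernel_mixture /giry_bind /= giry_int_map//.
exact: measurable_giry_ev.
Qed.

(** A disintegrated measure coincides with the bind of the Giry monad, whose integration formula is
    the iterated integral. *)
Lemma integral_kernel_mixture (mu : {measure set T2 -> \bar R}) (g : T2 -> \bar R) :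
  (forall A, measurable A -> mu A = \int[theta]_y k y A) ->
  measurable_fun [set: T2] g -> (forall x, 0 <= g x) ->
  \int[mu]_x g x = \int[theta]_y \int[k y]_x g x.
Proof.
move=> muE mg g0; rewrite (@eq_measure_integral _ _ _ _ kernel_mixture).
  exact: giry_int_bind.
by move=> A mA _; rewrite muE//; exact/esym/kernel_mixtureE.
Qed.

End kernel_integral.

Section skew_product_system.
Context {R : realType} {S : markov_shift} {X : pmetricType R}.
Notation Sigma := (shift_space S).
Notation A := (alphabet S).
Notation phase := (borel (Sigma * X)%type).
Variables (F : Sigma -> X -> X) (f : A -> X -> X).
Hypotheses (F_symbol : forall w, F w = f (symbol w 0)) (cf : forall a, continuous (f a)).

(** [F] is locally constant in [w]: on the clopen set where the symbol at 0 is fixed, it is a single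
    continuous [f a]. *)
Lemma continuous_skew : continuous (skew F).
Proof.
move=> [w t] B [[P Q] [/= Pw Qt] PQ].
have c1 : nbhs w (@shift S @^-1` P) by exact: (continuous_shift Pw).
have c2 : nbhs w [set v | symbol v 0 = symbol w 0].
  apply: open_nbhs_nbhs; split => //.
  exact: (symbol_clopen 0 (fun a => a = symbol w 0)).1.
have c3 : nbhs t (f (symbol w 0) @^-1` Q) by apply: cf; rewrite -F_symbol.
exists ((@shift S @^-1` P) `&` [set v | symbol v 0 = symbol w 0], f (symbol w 0) @^-1` Q).
  by split => //; exact: filterI.
move=> [v s] [/= [Pv vw] Qs]; apply: PQ; split => //=.
by rewrite F_symbol vw.
Qed.

Lemma continuous_iter_skew n : continuous (iter n (skew F)).
Proof.
elim: n => [|n IHn] x; first exact: cvg_id.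
by apply: continuous_comp; [exact: IHn|exact: continuous_skew].
Qed.

Lemma measurable_skew_preimage (B : set phase) : measurable B ->
  measurable (skew F @^-1` B : set phase).
Proof. by move=> mB; exact: (borel_preimage continuous_skew). Qed.

(** For a = v_(-1) this is [v] moved one place to the right. The symbol is a separate argument since
    a cylinder without past leaves v_(-1) free. *)
Definition unshift (a : A) (v : int -> A) (i : int) : A :=
  match i with
  | Posz 0 => a
  | Posz i.+1 => v (Posz i)
  | Negz i => v (Negz i.+1)
  end.

Lemma skew_preimage_box m k v (a : A) (U : set X) :
  [set x : Sigma * X | symbol x.1 0 = a] `&` (skew F @^-1` (cyl m k v `*` U)) =
  if (m == 0)%N || (v (Negz 0) == a)
  then cyl m.-1 k.+1 (unshift a v) `*` (f a @^-1` U) else set0.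
Proof.
apply/seteqP; split => [[w t] /= [wa [[wm wk] Uft]]|[w t]].
  have wv0 : (0 < m)%N -> v (Negz 0) = a by move=> m0; rewrite -(wm 0%N m0).
  case: ifPn => [_|]; last first.
    by rewrite negb_or -lt0n => /andP[/wv0 -> /eqP].
  split => /=; last by move: Uft; rewrite F_symbol wa.
  split => [i im|[|i] ik] //=.
    rewrite -(wm i.+1); last by rewrite -ltn_predRL.
    by rewrite /= /symbol/= -NegzS_add1.
  by rewrite -(wk i)// /symbol/= -PoszD addn1.
case: ifPn => // /orP h [[/= wm wk] Uft].
have wa : symbol w 0 = a by have := wk 0%N isT.
split => //=; split => /=; last by rewrite F_symbol wa.
split => [[|i] im|i ik].
- by case: h => [/eqP m0|/eqP ->]; [rewrite m0 in im|exact: wa].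
- rewrite -(wm i) ?ltn_predRL//; last by rewrite /symbol/= NegzS_add1.
- by have := wk i.+1 ik; rewrite /symbol/= -PoszD addn1.
Qed.

Variables (nu0 : A -> R) (nu0_prob : cylinder_probability nu0).
Variables (tau : probability (borel X) R) (tau_st : stationary nu0 f tau).

Fixpoint past_orbit (m : nat) (p : nat -> A) (t : X) : X :=
  if m is m'.+1 then f (p 0%N) (past_orbit m' (fun i => p i.+1) t) else t.

Lemma continuous_past_orbit m p : continuous (past_orbit m p).
Proof.
elim: m p => [|m IHm] p t; first exact: cvg_id.
by apply: continuous_comp; [exact: IHm|exact: cf].
Qed.

(* The mass that the natural extension of tau gives to the box cyl m k v x B:
   the symbols are independent, and t = F_(v_(-1)) o ... o F_(v_(-m)) (s) where
   s has law tau. *)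
Definition box_mass (m k : nat) (v : int -> A) (B : set X) : \bar R :=
  ((\prod_(i < m) nu0 (v (Negz i)) * \prod_(i < k) nu0 (v (Posz i)))%:E *
   tau (past_orbit m (fun i => v (Negz i)) @^-1` B))%E.

(** A preimage turns the symbol at -1 into the symbol at 0. When no past symbol is left,
    stationarity of [tau] accounts for the sum over the present symbol. Each push by [skew] thus
    makes boxes with one more past symbol correct. *)
Lemma box_mass_step (mu : probability phase R) (n : nat) :
  (forall m k v (U : set X), (m <= n)%N -> open U ->
     mu (cyl m k v `*` U) = box_mass m k v U) ->
  forall m k v (U : set X), (m <= n.+1)%N -> open U ->
     mu (skew F @^-1` (cyl m k v `*` U)) = box_mass m k v U.
Proof.
move=> hmu m k v U mn oU; have [n0 n1] := nu0_prob.
have oUa a : open (f a @^-1` U) by apply: open_comp => // x _; exact: cf.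
pose B a : set phase :=
  [set x : Sigma * X | symbol x.1 0 = a] `&` (skew F @^-1` (cyl m k v `*` U)).
have BE a : B a = _ := skew_preimage_box m k v a U.
have mB a : measurable (B a).
  rewrite BE; case: ifPn => // _.
  by apply: measurable_open; apply: open_cylinder_box; exact: oUa.
have -> : skew F @^-1` (cyl m k v `*` U) = \bigcup_a B a.
  by apply/seteqP; split => [x xB|x [a _ []]//]; exists (symbol x.1 0).
rewrite measure_bigcup_fintype//; last first.
  by apply/trivIsetP => a b _ _ ab; apply/seteqP; split => // x [[/= xa _] [/= xb _]];
    move/eqP : ab; apply; rewrite -xa -xb.
case: m mn B BE mB => [_|m mn] B BE mB.
  rewrite /box_mass big_ord0 mul1r/= tau_st; last exact: measurable_open.
  rewrite ge0_sume_distrr; last by move=> a _; rewrite mule_ge0 ?lee_fin.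
  apply: eq_bigr => a _; rewrite BE/= hmu//.
  by rewrite /box_mass big_ord0 mul1r/= big_ord_recl/= muleA -EFinM mulrC.
rewrite (bigD1 (v (Negz 0)))//= big1 ?adde0; last first.
  by move=> a av; rewrite BE/= eq_sym (negbTE av) measure0.
rewrite BE eqxx orbT hmu// /box_mass/=.
congr (_%:E * _)%E.
by rewrite !big_ord_recl/= mulrCA mulrA.
Qed.

End skew_product_system.

(** * Natural extension of a stationary measure *)

Section natural_extension.
Context {R : realType} {S : markov_shift} {X : pmetricType R}.
Notation Sigma := (shift_space S).
Notation Past := (past_space S).
Notation A := (alphabet S).
Notation phase := (borel (Sigma * X)%type).
Notation past_phase := (borel (Past * X)%type).
Hypothesis cX : compact [set: X].
Variables (F : Sigma -> X -> X) (f : A -> X -> X).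
Hypotheses (F_symbol : forall w, F w = f (symbol w 0)) (cf : forall a, continuous (f a)).
Variables (nu0 : A -> R) (nu0_prob : cylinder_probability nu0)
  (nu0_adm : bernoulli_admissible nu0).

Lemma exists_positive_past : exists w : Sigma, 0 < nu0 (symbol w (Negz 0)).
Proof.
have [a a0] := exists_positive_symbol nu0_prob.
have [g ag ga] := symbol_occurs a.
exists (shift (SigSub (mem_set ag))).
by rewrite (_ : symbol _ _ = a)// -ga.
Qed.

(** Complementation inside the box over [C]: [box_limit] asks for values on closed sets, while box
    masses are known on open ones. *)
Lemma closed_box_mass (mu : probability phase R) (C : set Sigma) (c : R)
    (tau : probability (borel X) R) : clopen C ->
  (forall U : set X, open U -> mu (C `*` U) = (c%:E * tau U)%E) ->
  forall K : set X, closed K -> mu (C `*` K) = (c%:E * tau K)%E.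
Proof.
move=> clC h K clK.
have mU (U : set X) : open U -> measurable (C `*` U : set phase).
  by move=> oU; apply: measurable_open; apply: open_setX => //; exact: clC.1.
have mK : measurable (C `*` K : set phase).
  rewrite (_ : C `*` K = (C `*` setT) `\` (C `*` ~` K)).
    by apply: measurableD; apply: mU; [exact: openT|exact: closed_openC].
  apply/seteqP; split => [[w t] [/= Cw Kt]|[w t] [[/= Cw _] h']].
    by split => // -[].
  by split => //=; apply: contrapT => nKt; apply: h'.
have mKX : measurable (K : set (borel X)) by exact: measurable_closed.
have : mu (C `*` setT) = (mu (C `*` K) + mu (C `*` ~` K))%E.
  rewrite -measureU//.
  - congr (mu _); apply/seteqP; split => [[w t] [/= Cw _]|[w t] [[]|[]]//].
    by have [Kt|Kt] := pselect (K t); [left|right].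
  - by apply: mU; exact: closed_openC.
  - by apply/seteqP; split => // -[w t] [[/= _ Kt] [/= _ /(_ Kt)]].
have tauT : tau [set: X] = 1%E := probability_setT tau.
rewrite (h setT openT) tauT (h (~` K)); last exact: closed_openC.
rewrite probability_setC// mule1.
have ftau : tau K \is a fin_num by exact: fin_num_measure.
have fmu : mu (C `*` K) \is a fin_num by exact: fin_num_measure.
rewrite -(fineK ftau) -(fineK fmu) -EFinB -!EFinM -EFinD => -[] hc.
by congr (_%:E); move: hc; rewrite mulrBr mulr1; lra.
Qed.

(** Starting from a frozen past and an i.i.d. future, n steps of [skew] give the right mass to every
    box with at most n past symbols, so the images stabilise on each box and [box_limit] applies. *)
Lemma exists_natural_extension (tau : probability (borel X) R) :
  stationary nu0 f tau ->
  exists eta : probability phase R, forall m k v (U : set X), open U ->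
    eta (cyl m k v `*` U) = box_mass f nu0 tau m k v U.
Proof.
move=> tau_st; have [n0 n1] := nu0_prob.
have [w0 w0pos] := exists_positive_past.
have [eta0 eta0E] := bernoulli_extension cX nu0_prob nu0_adm tau w0pos.
have citer := @continuous_iter_skew R S X F f F_symbol cf.
have boxE n : forall m k v (U : set X), (m <= n)%N -> open U ->
    eta0 (iter n (skew F) @^-1` (cyl m k v `*` U)) = box_mass f nu0 tau m k v U.
  elim: n => [|n IHn] m k v U.
    rewrite leqn0 => /eqP -> oU; rewrite [LHS]eta0E// /box_mass big_ord0 mul1r.
    rewrite (_ : `[< _ >] = true) ?mul1r; last by apply/asboolP.
    by rewrite EFinM fineK// fin_num_measure//; exact: measurable_open.
  have [mu muE] := pushforward_probability eta0 (citer n).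
  move=> mn oU.
  transitivity (mu (skew F @^-1` (cyl m k v `*` U))); first by rewrite muE.
  apply: (box_mass_step F_symbol cf nu0_prob tau_st (n := n)) => //.
  by move=> m' k' v' U' m'n oU'; rewrite muE /pushforward IHn.
pose m_ n (B : set (Sigma * X)) := fine (eta0 (iter n (skew F) @^-1` B)).
have cm n : closed_content (m_ n).
  apply: (@closed_content_preimage _ _ _ (iter n (skew F))
    (fun B => fine (eta0 B))) => //.
  exact: measure_closed_content.
have [eta etaE] := box_limit cX cm; exists eta => m k v U oU.
(* [tau'] is the law of the fibre point after the maps of the past word have acted on a point of law
   [tau]. *)
have [tau' tau'E] := pushforward_probability tau
  (@continuous_past_orbit R S X f cf m (fun i => v (Negz i))).
pose c := \prod_(i < m) nu0 (v (Negz i)) * \prod_(i < k) nu0 (v (Posz i)).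
have c0 : 0 <= c by apply: mulr_ge0; exact: prodr_ge0.
have clC := two_sided_cylinder_clopen m k v.
rewrite (etaE _ c tau' clC c0) => [||//].
  rewrite EFinM fineK ?fin_num_measure//; last exact: measurable_open.
  by rewrite tau'E.
exists m => // n /= mn K clK.
have [mu muE] := pushforward_probability eta0 (citer n).
have -> : m_ n (cyl m k v `*` K) = fine (mu (cyl m k v `*` K)) by rewrite muE.
rewrite (@closed_box_mass mu _ c tau' clC _ K clK).
  by rewrite fineM// fin_num_measure//; exact: measurable_closed.
by move=> V oV; rewrite muE tau'E /pushforward boxE.
Qed.

Section conditional_measures.
Variables (tau : probability (borel X) R) (tau_st : stationary nu0 f tau).
Variables (eta : probability phase R).
Hypothesis etaE : forall m k v (U : set X), open U ->
  eta (cyl m k v `*` U) = box_mass f nu0 tau m k v U.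

Lemma natural_extension_invariant : skew_invariant F eta.
Proof.
have [mu muE] := pushforward_probability eta (continuous_skew F_symbol cf).
move=> B mB; have -> : eta (skew F @^-1` B) = mu B by rewrite muE.
apply: eq_phase_measure mB => n u U oU; rewrite muE /pushforward etaE//.
apply: (box_mass_step F_symbol cf nu0_prob tau_st (n := n)) => // m k v V _ oV.
exact: etaE.
Qed.

Lemma natural_extension_projects : projects_to eta tau.
Proof.
have [mu muE] := pushforward_probability eta (@snd_continuous Sigma X).
move=> B mB; have -> : eta (snd @^-1` B) = mu B by rewrite muE.
apply: (@measure_unique _ R (borel X) (@open X) (fun=> setT)) => //.
- exact: openI.
- by move=> _; exact: openT.
- by rewrite bigcup_const.
- move=> U oU; transitivity (eta (snd @^-1` U)).
    exact: (congr1 (@^~ U) muE).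
  have := etaE 0 0 (fun=> symbol point 0) oU.
  rewrite /box_mass !big_ord0 mul1r mul1e/= => <-; congr (eta _).
  by apply/seteqP; split => [[w t] Ut|[w t] []].
- by move=> _; rewrite -ge0_fin_numE// fin_num_measure.
Qed.

Let w0 : Sigma := sval (cid exists_positive_past).

Let w0_pos : 0 < nu0 (symbol w0 (Negz 0)).
Proof. exact: svalP (cid exists_positive_past). Qed.

Let pick_past (p : Past) : {w : Sigma | past w = p}.
Proof.
apply: cid; case: p => p pP; have [w _ wp] := set_mem pP.
by exists w; apply: val_inj.
Qed.

(* A past ending with a symbol of mass 0 may admit no Bernoulli future; such
   pasts are negligible and are replaced by the past of w0. *)
Let rep (p : Past) : Sigma :=
  if 0 < nu0 (past_symbol p 0) then sval (pick_past p) else w0.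

Let rep_pos p : 0 < nu0 (symbol (rep p) (Negz 0)).
Proof.
rewrite /rep; case: ifPn => // p0.
by rewrite -past_symbolE (svalP (pick_past p)).
Qed.

(** The candidate conditional measures: the Dirac mass freezes the fibre point, and only the future
    is random. *)
Let kap (y : past_phase) : probability phase R :=
  sval (cid (bernoulli_extension cX nu0_prob nu0_adm
    (@dirac _ (borel X) y.2 R) (rep_pos y.1))).

Let match_past (p : Past) m (v : int -> A) : Prop :=
  forall i, (i < m)%N -> past_symbol p i = v (Negz i).

Let kapE y m k v (U : set X) : open U -> kap y (cyl m k v `*` U) =
  (`[< match_past (past (rep y.1)) m v >]%:R *
   \prod_(i < k) nu0 (v (Posz i)) * \1_U y.2)%:E.
Proof.
move=> oU; rewrite /kap; by case: cid => mu /= ->.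
Qed.

Let match_clopen m v : clopen [set p : Past | match_past p m v].
Proof.
have -> : [set p : Past | match_past p m v] =
    \bigcap_(i in `I_m) [set p | past_symbol p i = v (Negz i)].
  by apply/seteqP; split.
elim: m => [|m IHm]; first by rewrite II0 bigcap_set0; exact: clopenT.
rewrite IIS bigcap_setU bigcap_set1; apply: clopenI => //.
exact: (past_symbol_clopen m (fun a => a = v (Negz m))).
Qed.

Let good : set past_phase := [set y | 0 < nu0 (past_symbol y.1 0)].

Let good_clopen : clopen [set p : Past | 0 < nu0 (past_symbol p 0)].
Proof. exact: (past_symbol_clopen 0 (fun a => 0 < nu0 a)). Qed.

Let past_rep p : 0 < nu0 (past_symbol p 0) -> past (rep p) = p.
Proof. by rewrite /rep => ->; exact: svalP (pick_past p). Qed.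

Let measurable_past_set (P : set Past) : clopen P ->
  measurable ([set y | P y.1] : set past_phase).
Proof.
move=> [oP _]; apply: measurable_open.
rewrite (_ : [set y | P y.1] = fst @^-1` P)//; apply: open_comp => // x _.
exact: cvg_fst.
Qed.

Let measurable_kap (B : set phase) : measurable B -> measurable_fun setT (kap ^~ B).
Proof.
move: B; rewrite phase_measurableE; apply: (@dynkin_induction _ phase cylinder_boxes).
- exact: phase_measurableE.
- exact: cylinder_boxesI.
- by apply: (eq_measurable_fun (cst 1%E)) => // y _; rewrite probability_setT.
- move=> _ [n [u [U [oU ->]]]].
  (* The past chosen by [rep] matches [u] in two cases: the given past is kept and matches, or it is
     replaced and that of [w0] matches. *)
  pose E : set past_phase :=
    ([set y | match_past y.1 n u /\ 0 < nu0 (past_symbol y.1 0)] `|`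
     [set y | match_past (past w0) n u /\ ~ 0 < nu0 (past_symbol y.1 0)]) `&`
    [set y | U y.2].
  have mE : measurable E.
    apply: measurableI; last first.
      apply: measurable_open; rewrite (_ : [set y | U y.2] = snd @^-1` U)//.
      by apply: open_comp => // x _; exact: snd_continuous.
    apply: measurableU.
      apply: (measurable_past_set
        (P := [set p | match_past p n u /\ 0 < nu0 (past_symbol p 0)])).
      exact: clopenI (match_clopen _ _) good_clopen.
    apply: (measurable_past_set
      (P := [set p | match_past (past w0) n u /\ ~ 0 < nu0 (past_symbol p 0)])).
    apply: clopenI; last first.
      by split; [exact: closed_openC good_clopen.2|exact: open_closedC good_clopen.1].
    have [h|h] := pselect (match_past (past w0) n u).
      suff -> : (fun=> match_past (past w0) n u) = [set: Past] by exact: clopenT.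
      by apply/seteqP; split.
    suff -> : (fun=> match_past (past w0) n u) = set0 :> set Past by exact: clopen0.
    by apply/seteqP; split.
  apply: (eq_measurable_fun (fun y => (\prod_(i < n) nu0 (u (Posz i)) * \1_E y)%:E)).
    move=> y _; rewrite kapE//; congr (_%:E); rewrite mulrAC [RHS]mulrC; congr *%R.
    rewrite !indicE -natrM mulnb; congr (_%:R); congr nat_of_bool.
    rewrite /rep; apply/idP/idP.
      move=> /set_mem [[[mp g]|[mw ng]] Uy].
        by apply/andP; split; [apply/asboolP; rewrite -/(rep y.1) past_rep|exact/mem_set].
      apply/andP; split; last exact/mem_set.
      by apply/asboolP; rewrite (negbTE (introN idP ng)).
    move=> /andP[/asboolP mp /set_mem Uy]; apply/mem_set; split => //.
    have [g|g] := boolP (0 < nu0 (past_symbol y.1 0)).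
      by left; split => //; move: mp; rewrite -/(rep y.1) past_rep.
    by right; split; [move: mp; rewrite (negbTE g)|apply/negP].
  by apply/measurable_EFinP; apply: measurable_funM => //.
- move=> B mB IH; apply: (eq_measurable_fun (fun y => 1 - kap y B)%E).
    by move=> y _; rewrite probability_setC.
  by apply: emeasurable_funB.
- move=> B mB tB IH.
  apply: (eq_measurable_fun (fun y => \sum_(0 <= i <oo) kap y (B i))%E).
    by move=> y _; rewrite measure_semi_bigcup//; exact: bigcup_measurable.
  by apply: ge0_emeasurable_sum => // i y _ _; exact: measure_ge0.
Qed.

Let kernel_kap (y : past_phase) : {measure set phase -> \bar R} := kap y.

HB.instance Definition _ :=
  @isKernel.Build _ _ past_phase phase R kernel_kap measurable_kap.

HB.instance Definition _ := @Kernel_isProbability.Build _ _ past_phase phase R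
  kernel_kap (fun y => probability_setT (kap y)).

Lemma continuous_past_map : continuous (@past_map R S X : Sigma * X -> Past * X).
Proof.
move=> [w t] B [[P Q] [/= Pw Qt] PQ].
exists (@past S @^-1` P, Q); first by split => //; exact: (continuous_past Pw).
by move=> [v s] [/= Pv Qs]; exact: PQ.
Qed.

Let good_negligible : eta (past_map @^-1` (~` good)) = 0%E.
Proof.
have [n0 n1] := nu0_prob.
pose B a : set phase := if 0 < nu0 a then set0 else cyl 1 0 (fun=> a) `*` setT.
have mB a : measurable (B a).
  rewrite /B; case: ifP => // _; apply: measurable_open; apply: open_cylinder_box.
  exact: openT.
have -> : past_map @^-1` (~` good) = \bigcup_a B a.
  apply/seteqP; split => [[w t] /= ng|[w t] [a _]].
    exists (symbol w (Negz 0)) => //; rewrite /B ifN; last by apply/negP; exact: ng.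
    by split => //; split => // -[].
  rewrite /B; case: ifPn => // na [[/= wa _] _].
  by rewrite /good/= past_symbolE wa //; exact/negP.
rewrite measure_bigcup_fintype//.
  rewrite big1// => a _; rewrite /B; case: ifPn => [_|na]; first by rewrite measure0.
  rewrite [LHS]etaE; last exact: openT.
  rewrite /box_mass big_ord1 big_ord0 (_ : nu0 a = 0) ?mul0r ?mul0e//.
  by apply/eqP; rewrite eq_le n0 andbT leNgt.
apply/trivIsetP => a b _ _ ab; apply/seteqP; split => // x [].
rewrite /B; case: ifPn => // _ [[/= wa _] _]; case: ifPn => // _ [[/= wb _] _].
by move/eqP : ab; apply; rewrite -(wa 0%N) // -(wb 0%N).
Qed.

(** Leaving the fibre means disagreeing with one of the finite pasts of [y.1] or with the point
    [y.2]: countably many events, each null by [kapE]. *)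
Let kap_fiber y : good y -> kap y (unstable_set y.1 `*` [set y.2]) = 1%E.
Proof.
move=> gy; have rp := past_rep gy; set w := rep y.1 in rp.
pose N : set phase := (\bigcup_n ~` (cyl n 0 (symbol w) `*` setT)) `|`
  (cyl 0 0 (symbol w) `*` ~` [set y.2]).
have mc n : measurable (cyl n 0 (symbol w) `*` setT : set phase).
  by apply: measurable_open; apply: open_cylinder_box; exact: openT.
have o2 : open (~` [set y.2]).
  apply: closed_openC; apply: accessible_closed_set1.
  apply: hausdorff_accessible; exact: metric_hausdorff.
have mN : measurable N.
  apply: measurableU; first by apply: bigcup_measurable => n _; exact: measurableC.
  by apply: measurable_open; exact: open_cylinder_box.
have -> : unstable_set y.1 `*` [set y.2] = ~` N.
  apply/seteqP; split => [[v t] [/= vy ->] [[n _]|[_ /(_ erefl)]]//|[v t] nN].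
    apply; split => //; split => // i _.
    by rewrite -!past_symbolE vy rp.
  split => /=.
    rewrite /unstable_set/= -rp; apply: val_inj; apply/funext => i.
    apply: contrapT => h; apply: nN; left; exists i.+1 => // -[[/= h' _] _].
    by apply: h; exact: h'.
  by apply: contrapT => h; apply: nN; right.
rewrite probability_setC// (_ : kap y N = 0%E) ?sube0//.
apply/negligibleP => //; apply: negligibleU; last first.
  apply/negligibleP; first by apply: measurable_open; exact: open_cylinder_box.
  rewrite [LHS]kapE// indicE memNset ?mulr0//.
  by move=> /(_ erefl).
apply: negligible_bigcup => n; apply/negligibleP; first exact: measurableC.
rewrite [LHS](probability_setC (kap y) (mc n)) [X in (1 - X)%E]kapE; last exact: openT.
rewrite big_ord0 indicE in_setT (_ : `[< _ >] = true) ?mulr1 ?subee//.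
by apply/asboolP => i _.
Qed.

(** The identity is checked on boxes, where past and future are independent. The last clause, the
    common law of future words, is what makes the entropy computable. *)
Lemma natural_extension_disintegration :
  exists2 kappa : R.-pker past_phase ~> phase, disintegration eta kappa &
    forall y k v, kappa y (cyl 0 k v `*` setT) = (\prod_(i < k) nu0 (v (Posz i)))%:E.
Proof.
exists kernel_kap; last first.
  move=> y k v; rewrite [LHS]kapE; last exact: openT.
  rewrite indicE in_setT (_ : `[< _ >] = true) ?mulr1 ?mul1r//.
  by apply/asboolP.
have [theta thetaE] := pushforward_probability eta continuous_past_map.
rewrite /disintegration -thetaE.
have mgood : measurable (~` good).
  by apply: measurableC; apply: (measurable_past_set good_clopen).
have ngood : theta.-negligible (~` good).
  apply/negligibleP => //.
  exact: (etrans (congr1 (@^~ _) thetaE) good_negligible).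
split.
  by apply: negligibleS ngood => y /= h; apply: contra_not h; exact: kap_fiber.
move=> B mB; rewrite -kernel_mixtureE//.
apply: (@measure_unique _ R phase cylinder_boxes (fun=> setT)) => //.
- exact: phase_measurableE.
- exact: cylinder_boxesI.
- move=> _; exists 0%N, (fun=> symbol point 0), setT; split; first exact: openT.
  by apply/seteqP; split => // -[w t].
- by rewrite bigcup_const.
- move=> _ [n [u [U [oU ->]]]].
  have mbox : measurable (cyl n n u `*` U : set phase).
    by apply: measurable_open; exact: open_cylinder_box.
  pose E : set past_phase := [set y | match_past y.1 n u] `&` [set y | U y.2].
  have mE : measurable E.
    apply: measurableI; first exact: (measurable_past_set (match_clopen n u)).
    apply: measurable_open; rewrite (_ : [set y | U y.2] = snd @^-1` U)//.
    by apply: open_comp => // x _; exact: snd_continuous.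
  rewrite [RHS]kernel_mixtureE//.
  rewrite (@ae_eq_integral _ _ _ theta setT
    (fun y => (\prod_(i < n) nu0 (u (Posz i)) * \1_E y)%:E))//.
  + under eq_integral do rewrite EFinM.
    rewrite ge0_integralZl//; last 2 first.
    * by apply/measurable_EFinP; exact: measurable_indic.
    * by rewrite lee_fin prodr_ge0// => i _; exact: nu0_prob.1.
    rewrite integral_indic// setIT [LHS]etaE//.
    (* The future symbols factor out, and the remaining box is the preimage of [E] under
       [past_map]. *)
    transitivity ((\prod_(i < n) nu0 (u (Posz i)))%:E * eta (cyl n 0 u `*` U))%E.
      by rewrite etaE// /box_mass big_ord0 mulr1 mulrC EFinM muleA.
    congr (_ * _)%E; apply/esym/(etrans (congr1 (@^~ E) thetaE)); congr (eta _).
    by apply/seteqP; split => [[w t] [mp Ut]|[w t] [[mp _] Ut]].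
  + exact: measurable_kap.
  + by apply/measurable_EFinP; apply: measurable_funM => //; exact: measurable_indic.
  + apply: negligibleS ngood => y /= h; apply: contra_not h => gy _.
    rewrite [LHS]kapE// past_rep//; congr (_%:E); rewrite mulrAC [LHS]mulrC; congr *%R.
    rewrite !indicE -natrM mulnb; congr (_%:R); congr nat_of_bool.
    apply/idP/idP => [/andP[/asboolP mp /set_mem Uy]|]; first exact/mem_set.
    by rewrite inE => -[mp Uy]; apply/andP; split; [exact/asboolP|exact/mem_set].
- by move=> _; rewrite -ge0_fin_numE// fin_num_measure.
Qed.

End conditional_measures.
End natural_extension.

(** * Gibbs inequality along orbits *)

(** Apply ln x <= x - 1 at x = q_i / p_i, multiply by p_i and sum. The last hypothesis keeps
    [ln (q i)] away from the conventional value of [ln] at 0. *)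
Lemma gibbs_inequality (R : realType) (I : finType) (p q : I -> R) :
  (forall i, 0 <= p i) -> \sum_i p i = 1 -> (forall i, 0 <= q i) -> \sum_i q i <= 1 ->
  (forall i, 0 < p i -> 0 < q i) ->
  - \sum_i p i * ln (p i) <= \sum_i p i * - ln (q i).
Proof.
move=> p0 p1 q0 q1 pq; rewrite -subr_ge0 opprK -big_split/=.
apply: (@le_trans _ _ (\sum_i (p i - q i))).
  by rewrite sumrB p1 subr_ge0.
apply: ler_sum => i _; have [pi0|pi0] := leP (p i) 0.
  have -> : p i = 0 by apply/eqP; rewrite eq_le pi0 p0.
  by rewrite !mul0r addr0 sub0r oppr_le0.
have qi0 := pq _ pi0.
have : ln (q i / p i) <= q i / p i - 1.
  have := @le_ln1Dx R (q i / p i - 1); rewrite [1 + _]addrC subrK; apply.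
  by rewrite ltrBrDr addNr divr_gt0.
rewrite ln_div ?posrE// => /(ler_wpM2l (ltW pi0)).
rewrite [in X in _ <= X]mulrBr mulr1 mulrCA divff ?gt_eqF// mulr1; lra.
Qed.

Lemma ln_prod (R : realType) (I : finType) (h : I -> R) :
  (forall i, 0 < h i) -> ln (\prod_i h i) = \sum_i ln (h i).
Proof.
move=> h0; suff [] : 0 < \prod_i h i /\ ln (\prod_i h i) = \sum_i ln (h i) by [].
elim/big_rec2 : _ => [|i x y _ [y0 IH]]; first by rewrite ln1.
by rewrite mulr_gt0// lnM ?posrE// IH.
Qed.

Lemma sum_ffun_cons (R : nmodType) (I : finType) (n : nat)
    (G : {ffun 'I_n.+1 -> I} -> R) :
  \sum_u G u =
  \sum_a \sum_(v : {ffun 'I_n -> I})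
    G [ffun i => if unlift ord0 i is Some j then v j else a].
Proof.
rewrite pair_big/= (reindex (fun av : I * {ffun 'I_n -> I} =>
  [ffun i => if unlift ord0 i is Some j then av.2 j else av.1] : {ffun 'I_n.+1 -> I}))//=.
exists (fun u => (u ord0, [ffun j => u (lift ord0 j)])) => [[a v] _|u _] /=.
  congr pair; first by rewrite ffunE unlift_none.
  by apply/ffunP => j; rewrite !ffunE liftK.
by apply/ffunP => i; rewrite !ffunE; case: unliftP => [j ->|->]; rewrite ?ffunE.
Qed.

Section gibbs_for_skew_products.
Context {R : realType} {S : markov_shift} {X : pmetricType R}.
Notation Sigma := (shift_space S).
Notation Past := (past_space S).
Notation A := (alphabet S).
Notation phase := (borel (Sigma * X)%type).
Notation past_phase := (borel (Past * X)%type).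
Variables (F : Sigma -> X -> X) (f : A -> X -> X).
Hypotheses (F_symbol : forall w, F w = f (symbol w 0)) (cf : forall a, continuous (f a)).

(** Here [u 0] acts first, whereas in [past_orbit] the entry of index 0 acts last. *)
Fixpoint word_orbit (n : nat) (u : nat -> A) (t : X) : X :=
  if n is n'.+1 then word_orbit n' (fun i => u i.+1) (f (u 0%N) t) else t.

Lemma word_orbitSr n u t : word_orbit n.+1 u t = f (u n) (word_orbit n u t).
Proof. by elim: n u t => // n IHn u t; rewrite [LHS]IHn. Qed.

Lemma word_orbit_skew (x : Sigma * X) n :
  (iter n (skew F) x).2 = word_orbit n (fun i => symbol (iter i (skew F) x).1 0) x.2.
Proof.
elim: n => // n IHn; rewrite word_orbitSr -IHn iterS /=.
by rewrite /skew/= F_symbol.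
Qed.

Lemma eq_word_orbit n u v t : (forall i, (i < n)%N -> u i = v i) ->
  word_orbit n u t = word_orbit n v t.
Proof.
elim: n u v t => // n IHn u v t uv /=; rewrite (uv 0%N)//; apply: IHn => i i_n.
exact: uv.
Qed.

Definition word_letter (n : nat) (u : {ffun 'I_n -> A}) (i : nat) : A :=
  if insub i is Some j then u j else symbol point 0.

Lemma word_letterE n (u : {ffun 'I_n -> A}) (i : 'I_n) : word_letter u i = u i.
Proof. by rewrite /word_letter valK. Qed.

Variable r : A -> X -> R.
Hypotheses (mr : forall a, measurable_fun setT (r a : borel X -> R))
  (r_ge0 : forall a t, 0 <= r a t) (r_le1 : forall t, \sum_a r a t <= 1).

(** The weight of [u] for the process that at a fibre point s emits the symbol a with mass [r a s]
    and moves to [f a s]. *)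
Definition word_weight (n : nat) (u : {ffun 'I_n -> A}) (t : X) : R :=
  \prod_(i < n) r (u i) (word_orbit i (word_letter u) t).

(** After the first letter a, the rest is a word emitted from [f a t], of total weight at most 1 by
    induction. *)
Lemma sum_word_weight n t : \sum_(u : {ffun 'I_n -> A}) word_weight u t <= 1.
Proof.
elim: n t => [|n IHn] t.
  rewrite (big_pred1 [ffun=> symbol point 0]) /word_weight ?big_ord0// => u.
  by apply/esym/eqP/ffunP => -[].
rewrite sum_ffun_cons; apply: le_trans (r_le1 t); apply: ler_sum => a _.
apply: le_trans (_ : \sum_(v : {ffun 'I_n -> A}) r a t * word_weight v (f a t) <= _).
  apply: ler_sum => v _; rewrite /word_weight big_ord_recl/= ffunE unlift_none.
  rewrite le_eqVlt; apply/orP; left; apply/eqP; congr *%R.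
  apply: eq_bigr => i _; rewrite ffunE liftK /=; congr (r _ _).
  set c := [ffun _ => _].
  have c0 : word_letter c 0%N = a by rewrite (word_letterE c ord0) ffunE unlift_none.
  rewrite c0; apply: eq_word_orbit => j ji.
  have jn : (j < n)%N := ltn_trans ji (ltn_ord i).
  rewrite (word_letterE v (Ordinal jn)) -[j.+1]/(nat_of_ord (lift ord0 (Ordinal jn))).
  by rewrite word_letterE ffunE liftK.
by rewrite -mulr_sumr ler_piMr.
Qed.

Lemma word_weight_ge0 n (u : {ffun 'I_n -> A}) t : 0 <= word_weight u t.
Proof. exact: prodr_ge0. Qed.

Lemma r_le_one a t : r a t <= 1.
Proof.
apply: le_trans (r_le1 t); rewrite (bigD1 a)//= lerDl; exact: sumr_ge0.
Qed.

Definition log_loss (x : Sigma * X) : R := - ln (r (symbol x.1 0) x.2).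

Lemma log_loss_ge0 x : 0 <= log_loss x.
Proof. by rewrite oppr_ge0 ln_le0// r_le_one. Qed.

Lemma measurable_cell (a : A) : measurable (first_symbol_cell a : set phase).
Proof.
apply: measurable_open; apply: open_setX; last exact: openT.
exact: (symbol_clopen 0 (fun b => b = a)).1.
Qed.

Lemma measurable_iter_skew n (B : set phase) : measurable B ->
  measurable (iter n (skew F) @^-1` B : set phase).
Proof.
by apply: borel_preimage; exact: (continuous_iter_skew F_symbol cf).
Qed.

Lemma measurable_join_cell n (u : {ffun 'I_n -> A}) :
  measurable (join_cell F u : set phase).
Proof.
rewrite /join_cell; apply: fin_bigcap_measurable; first exact: finite_finset.
by move=> i _; apply: measurable_iter_skew; exact: measurable_cell.
Qed.

Lemma measurable_log_loss : measurable_fun setT (log_loss : phase -> R).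
Proof.
apply: (eq_measurable_fun (fun x : phase =>
    \sum_(a : A) (\1_(first_symbol_cell a) x * - ln (r a x.2)))).
  move=> x _; rewrite (bigD1 (symbol x.1 0))//= big1 ?addr0.
    by rewrite indicE mem_set ?mul1r.
  move=> a ax; rewrite indicE memNset ?mul0r// => -[/= xa _].
  by move/eqP : ax; apply; rewrite -xa.
apply: measurable_sum => a; apply: measurable_funM.
  by apply: measurable_indic; exact: measurable_cell.
apply: measurable_funN; apply: measurableT_comp; first exact: measurable_ln.
apply: (@measurableT_comp _ _ _ phase (borel X) _ (r a)) => //.
by apply: borel_measurable_continuous; exact: snd_continuous.
Qed.

Lemma join_cell_letter n (u : {ffun 'I_n -> A}) (x : Sigma * X) (i : nat) :
  join_cell F u x -> (i < n)%N -> symbol (iter i (skew F) x).1 0 = word_letter u i.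
Proof.
move=> xu i_n; rewrite (word_letterE u (Ordinal i_n)).
by have [] := xu (Ordinal i_n) I.
Qed.

Lemma measurable_fibre (y : Past * X) :
  measurable (unstable_set y.1 `*` [set y.2] : set phase).
Proof.
have -> : unstable_set y.1 `*` [set y.2] =
    ~` (\bigcup_n ([set w | symbol w (Negz n) <> past_symbol y.1 n] `*` setT) `|`
        setT `*` ~` [set y.2]) :> set phase.
  apply/seteqP; split => [[w t] [/= wy ->] [[n _ [/= h _]]|[_ /(_ erefl)]]//|[w t] nN].
    by apply: h; rewrite -past_symbolE wy.
  split => /=.
    rewrite /unstable_set/=; apply: val_inj; apply/funext => i.
    by apply: contrapT => h; apply: nN; left; exists i.
  by apply: contrapT => h; apply: nN; right.
apply: measurableC; apply: measurableU.
  apply: bigcup_measurable => n _; apply: measurable_open.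
  apply: open_setX; last exact: openT.
  exact: (symbol_clopen (Negz n) (fun a => a <> past_symbol y.1 n)).1.
apply: measurable_open; apply: open_setX; first exact: openT.
apply: closed_openC; apply: accessible_closed_set1.
by apply: hausdorff_accessible; exact: metric_hausdorff.
Qed.

Lemma measurable_snd_eq (t : X) : measurable ([set x | x.2 = t] : set phase).
Proof.
have -> : [set x | x.2 = t] = ~` (setT `*` ~` [set t]) :> set phase.
  apply/seteqP; split => [[w s] /= -> [_ /(_ erefl)]//|[w s] h].
  by apply: contrapT => st; apply: h.
apply: measurableC; apply: measurable_open; apply: open_setX; first exact: openT.
apply: closed_openC; apply: accessible_closed_set1.
by apply: hausdorff_accessible; exact: metric_hausdorff.
Qed.


Definition orbit_loss (n : nat) (x : Sigma * X) : R :=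
  \sum_(i < n) log_loss (iter i (skew F) x).

Lemma measurable_orbit_loss n : measurable_fun setT (orbit_loss n : phase -> R).
Proof.
apply: measurable_sum => i.
apply: (@measurableT_comp _ _ _ phase phase R log_loss); first exact: measurable_log_loss.
by apply: borel_measurable_continuous; exact: (continuous_iter_skew F_symbol cf).
Qed.

Lemma orbit_loss_cell n (u : {ffun 'I_n -> A}) (x : Sigma * X) : join_cell F u x ->
  orbit_loss n x = \sum_(i < n) - ln (r (u i) (word_orbit i (word_letter u) x.2)).
Proof.
move=> xu; apply: eq_bigr => i _; rewrite /log_loss (join_cell_letter xu)// word_letterE.
rewrite word_orbit_skew (@eq_word_orbit _ _ (word_letter u))// => j ji.
exact: (join_cell_letter xu (ltn_trans ji (ltn_ord i))).
Qed.

Lemma trivIset_join_cell n : trivIset setT (fun u : {ffun 'I_n -> A} => join_cell F u).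
Proof.
apply/trivIsetP => u v _ _ uv; apply/seteqP; split => // x [xu xv].
move/eqP : uv; apply; apply/ffunP => i.
by have [<- _] := xu i I; have [<- _] := xv i I.
Qed.

Lemma bigcup_join_cell n : \bigcup_(u : {ffun 'I_n -> A}) join_cell F u = setT.
Proof.
apply/seteqP; split => // x _.
exists [ffun i : 'I_n => symbol (iter i (skew F) x).1 0] => // i _.
by split => //=; rewrite /cylinder/= ffunE.
Qed.

Local Open Scope ereal_scope.

(** On a single fibre the loss is constant on each cell, and on a charged cell it is minus the
    logarithm of the word weight. The claim is then Gibbs' inequality against these subprobability
    weights. *)
Lemma entropy_le_orbit_loss (mu : probability phase R) (t : X) n :
  mu [set x | x.2 = t] = 1 ->
  (forall u : {ffun 'I_n -> A}, mu (join_cell F u) != 0 ->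
     forall i, (0 < r (u i) (word_orbit i (word_letter u) t))%R) ->
  (partition_entropy mu (fun u : {ffun 'I_n -> A} => join_cell F u))%:E <=
  \int[mu]_x (orbit_loss n x)%:E.
Proof.
move=> mut mupos.
pose C (u : {ffun 'I_n -> A}) : set phase := join_cell F u.
have mC u : measurable (C u) by exact: measurable_join_cell.
pose p u : R := fine (mu (C u)).
have muE u : mu (C u) = (p u)%:E by rewrite /p fineK// fin_num_measure.
have p0 u : (0 <= p u)%R by exact: fine_ge0.
have tC : trivIset setT C by exact: trivIset_join_cell.
have p1 : (\sum_u p u = 1)%R.
  have muC : mu (\bigcup_u C u) = 1.
    by rewrite [\bigcup_u C u]bigcup_join_cell; exact: probability_setT.
  move: muC; rewrite measure_bigcup_fintype// (eq_bigr _ (fun u _ => muE u)).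
  by rewrite sumEFin => -[].
pose g (u : {ffun 'I_n -> A}) : R :=
  (\sum_(i < n) - ln (r (u i) (word_orbit i (word_letter u) t)))%R.
have -> : \int[mu]_x (orbit_loss n x)%:E = (\sum_u p u * g u)%:E.
  have -> : [set: phase] = \big[setU/set0]_(u <- index_enum {ffun 'I_n -> A}) C u.
    rewrite -bigcup_seq -[LHS](@bigcup_join_cell n); apply/seteqP; split => x [u uu xu];
      by exists u => //=; rewrite mem_index_enum.
  rewrite ge0_integral_bigsetU//.
  - rewrite -sumEFin; apply: eq_bigr => u _.
    rewrite (ae_eq_integral (cst (g u)%:E))//.
    + by rewrite integral_cst// EFinM [LHS]muleC; congr (_ * _); exact: muE.
    + by apply/measurable_EFinP; apply: measurable_funTS; exact: measurable_orbit_loss.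
    + apply: (@negligibleS _ _ _ mu (~` [set x | x.2 = t])).
        move=> x /= h; apply: contra_not h => xt xu.
        by rewrite (orbit_loss_cell xu) xt.
      apply/negligibleP; first by apply: measurableC; exact: measurable_snd_eq.
      by rewrite [LHS](probability_setC mu (measurable_snd_eq t)) mut subee.
  - exact: index_enum_uniq.
  - by apply: sub_trivIset tC.
  - by apply/measurable_EFinP; apply: measurable_funTS; exact: measurable_orbit_loss.
  - by move=> x _; rewrite lee_fin sumr_ge0// => i _; exact: log_loss_ge0.
rewrite lee_fin /partition_entropy.
pose q (u : {ffun 'I_n -> A}) := if (p u == 0)%R then 0%R else word_weight u t.
have ppos u : (0 < p u)%R -> forall i, (0 < r (u i) (word_orbit i (word_letter u) t))%R.
  by move=> pu; apply: mupos; rewrite [mu _]muE eqe gt_eqF.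
have -> : (\sum_u p u * g u = \sum_u p u * - ln (q u))%R.
  apply: eq_bigr => u _; rewrite /q; case: eqVneq => [->|pu]; first by rewrite !mul0r.
  have pu0 : (0 < p u)%R by rewrite lt_neqAle eq_sym pu p0.
  congr *%R; rewrite /g /word_weight sumrN; congr (- _)%R.
  by rewrite ln_prod//; exact: ppos.
apply: gibbs_inequality => //.
- by move=> u; rewrite /q; case: ifP => // _; exact: word_weight_ge0.
- apply: le_trans (sum_word_weight n t); apply: ler_sum => u _.
  by rewrite /q; case: ifP => // _; exact: word_weight_ge0.
- by move=> u pu; rewrite /q gt_eqF//; apply: prodr_gt0 => i _; exact: ppos.
Qed.

End gibbs_for_skew_products.

Lemma limn_esup_le_bound (R : realType) (u : (\bar R)^nat) (C : \bar R) :
  (forall n, (u n <= C)%E) -> (limn_esup u <= C)%E.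
Proof.
move=> uC; rewrite limn_esup_lim; apply: lime_le; first exact: is_cvg_esups.
by apply: nearW => n; apply: ge_ereal_sup => _ [k _ <-].
Qed.

(** * Upper bound for the entropy out of equilibrium *)

Section entropy_bound.
Context {R : realType} {S : markov_shift} {X : pmetricType R}.
Notation Sigma := (shift_space S).
Notation Past := (past_space S).
Notation A := (alphabet S).
Notation phase := (borel (Sigma * X)%type).
Notation past_phase := (borel (Past * X)%type).
Variables (F : Sigma -> X -> X) (f : A -> X -> X).
Hypotheses (F_symbol : forall w, F w = f (symbol w 0)) (cf : forall a, continuous (f a)).
Variables (eta : probability phase R) (eta_inv : skew_invariant F eta).
Variables (kappa : R.-pker past_phase ~> phase) (eta_dis : disintegration eta kappa).
Local Open Scope ereal_scope.

Lemma skew_invariant_iter n (B : set phase) : measurable B ->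
  eta (iter n (skew F) @^-1` B) = eta B.
Proof.
move=> mB; elim: n => // n IHn; rewrite -[RHS]IHn.
rewrite -(eta_inv (measurable_iter_skew F_symbol cf n mB)); congr (eta _).
by apply/seteqP; split => x /=; rewrite -iterSr.
Qed.

Lemma integral_iter_skew n (g : phase -> \bar R) :
  measurable_fun setT g -> (forall x, 0 <= g x) ->
  \int[eta]_x g (iter n (skew F) x) = \int[eta]_x g x.
Proof.
move=> mg g0.
have c := @continuous_iter_skew R S X F f F_symbol cf n.
have mi := borel_measurable_continuous c.
rewrite -(@ge0_integral_pushforward _ _ phase phase R _ mi eta setT g)//.
have [mu muE] := pushforward_probability eta c; rewrite -muE.
apply: eq_measure_integral => B mB _.
exact: (etrans (congr1 (@^~ B) muE) (skew_invariant_iter n mB)).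
Qed.

Lemma partition_entropy_ge0 (mu : probability phase R) (I : finType)
    (P : I -> set phase) :
  (forall i, measurable (P i)) -> (0 <= partition_entropy mu P)%R.
Proof.
move=> mP; rewrite /partition_entropy oppr_ge0; apply: sumr_le0 => i _.
rewrite mulr_ge0_le0 ?fine_ge0// ln_le0// -lee_fin fineK ?fin_num_measure//.
exact: probability_le1.
Qed.

Lemma measurable_partition_entropy n : measurable_fun setT
  (fun y : past_phase => partition_entropy (kappa y) (@join_cell _ _ _ F n)).
Proof.
apply: measurable_funN; apply: measurable_sum => u.
have m : measurable_fun setT (fun y : past_phase => fine (kappa y (join_cell F u))).
  apply: (measurableT_comp (f := fine)) => //.
  by apply: measurable_kernel; exact: (measurable_join_cell F_symbol cf).
apply: measurable_funM => //; apply: measurableT_comp => //; exact: measurable_ln.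
Qed.

Variable r : A -> X -> R.
Hypotheses (mr : forall a, measurable_fun setT (r a : borel X -> R))
  (r_ge0 : forall a t, (0 <= r a t)%R) (r_le1 : forall t, (\sum_a r a t <= 1)%R)
  (r_gt0 : forall a, eta (first_symbol_cell a) = 0 \/ forall t, (0 < r a t)%R).

Let null_symbols : set phase :=
  \bigcup_(a in [set a | eta (first_symbol_cell a) = 0]) first_symbol_cell a.

(** Points whose forward orbit meets a symbol not charged by [eta]. They are null by invariance, and
    off them [r] is positive along the orbit by [r_gt0]. *)
Let null_orbits : set phase := \bigcup_n (iter n (skew F) @^-1` null_symbols).

Let measurable_null_symbols : measurable null_symbols.
Proof.
apply: fin_bigcup_measurable; first exact: finite_finset.
by move=> a _; exact: measurable_cell.
Qed.

Let measurable_null_orbits : measurable null_orbits.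
Proof. by apply: bigcup_measurable => n _; exact: (measurable_iter_skew F_symbol cf). Qed.

Let eta_null_orbits : eta null_orbits = 0.
Proof.
apply/negligibleP => //; apply: negligible_bigcup => n.
apply/negligibleP; first exact: (measurable_iter_skew F_symbol cf).
rewrite [LHS]skew_invariant_iter//.
pose B a : set phase :=
  if eta (first_symbol_cell a) == 0 then first_symbol_cell a else set0.
have mB a : measurable (B a) by rewrite /B; case: ifP => // _; exact: measurable_cell.
have -> : null_symbols = \bigcup_a B a.
  apply/seteqP; split => x [a]; first by move=> /= a0 xa; exists a; rewrite // /B a0 eqxx.
  by move=> _; rewrite /B; case: ifPn => // /eqP a0 xa; exists a.
rewrite measure_bigcup_fintype//.
  by rewrite big1// => a _; rewrite /B; case: ifPn => [/eqP //|_]; rewrite measure0.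
apply/trivIsetP => a b _ _ ab; apply/seteqP; split => // x [].
rewrite /B; case: ifP => // _ [/= xa _]; case: ifP => // _ [/= xb _].
by move/eqP : ab; apply; rewrite -xa -xb.
Qed.

Lemma integral_orbit_loss n :
  \int[eta]_x (orbit_loss F r n x)%:E = n%:R%:E * \int[eta]_x (log_loss r x)%:E.
Proof.
have mloss : measurable_fun setT (fun x : phase => (log_loss r x)%:E).
  by apply/measurable_EFinP; exact: measurable_log_loss.
have loss0 (x : phase) : 0 <= (log_loss r x)%:E.
  by rewrite lee_fin; exact: (log_loss_ge0 r_ge0 r_le1).
rewrite /orbit_loss; under eq_integral do rewrite -sumEFin.
rewrite ge0_integral_sum//.
  under eq_bigr do rewrite (integral_iter_skew _ mloss loss0).
  by rewrite mule_natl sumr_const card_ord.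
move=> i.
apply: (@measurableT_comp _ _ _ phase phase _ (fun x => (log_loss r x)%:E)) => //.
by apply: borel_measurable_continuous; exact: (continuous_iter_skew F_symbol cf).
Qed.

(** Integrating the fibrewise bound over the quotient gives the integral of the orbit loss against
    [eta], which by invariance is n times that of [log_loss]; the factor 1/n cancels n. *)
Lemma entropy_along_le_log_loss :
  entropy_along F eta kappa <= \int[eta]_x (log_loss r x)%:E.
Proof.
apply: limn_esup_le_bound => n.
have [theta thetaE] := pushforward_probability eta (@continuous_past_map R S X).
have [dis1 dis2] := eta_dis; rewrite -thetaE in dis1 dis2 *.
have mloss := measurable_orbit_loss F_symbol cf mr n.
have loss0 x : 0 <= (orbit_loss F r n x)%:E.
  by rewrite lee_fin sumr_ge0// => i _; exact: (log_loss_ge0 r_ge0 r_le1).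
have mint : measurable_fun setT
    (fun y : past_phase => \int[kappa y]_x (orbit_loss F r n x)%:E).
  apply: measurable_fun_integral_kernel => //; last exact/measurable_EFinP.
  by move=> U mU; exact: measurable_kernel.
(* Almost every conditional measure ignores the null orbits, since these masses integrate to the
   mass for [eta]. *)
have nullk : {ae theta, forall y, kappa y null_orbits = 0}.
  have := @ae_eq_integral_abs _ past_phase R theta setT measurableT
    (fun y => kappa y null_orbits).
  move=> /(_ (measurable_kernel kappa _ measurable_null_orbits)) [h _].
  have : \int[theta]_y `|kappa y null_orbits| = 0.
    by under eq_integral do rewrite gee0_abs//; rewrite -dis2.
  by move=> /h; apply: filterS => y /(_ I).
apply: (@le_trans _ _
  (\int[theta]_y (n%:R^-1%:E * \int[kappa y]_x (orbit_loss F r n x)%:E))).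
  apply: ae_ge0_le_integral => //.
  - move=> y _; rewrite lee_fin mulr_ge0//.
    have [mu <-] := kernel_probability kappa y; apply: partition_entropy_ge0.
    by move=> u; exact: (measurable_join_cell F_symbol cf).
  - apply/measurable_EFinP; apply: measurable_funM => //.
    exact: measurable_partition_entropy.
  - by move=> y _; rewrite mule_ge0 ?lee_fin// integral_ge0.
  - by apply: measurable_funeM.
  apply: filterS2 dis1 nullk => y fibre null _.
  rewrite EFinM; apply: lee_wpmul2l; first by rewrite lee_fin.
  have [mu muE] := kernel_probability kappa y; rewrite -muE in fibre null *.
  apply: (entropy_le_orbit_loss F_symbol cf mr r_ge0 r_le1 (t := y.2)).
    apply/eqP; rewrite eq_le; apply/andP; split.
      by apply: probability_le1; exact: measurable_snd_eq.
    rewrite -fibre; apply: le_measure.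
    + by rewrite inE; exact: measurable_fibre.
    + by rewrite inE; exact: measurable_snd_eq.
    + by move=> x [].
  (* A letter not charged by [eta] would put the whole cell into the null orbits. *)
  move=> u mu_u i; have [ui0|//] := r_gt0 (u i).
  exfalso; move/eqP : mu_u; apply; apply/eqP; rewrite eq_le measure_ge0 andbT -null.
  apply: le_measure; rewrite ?inE//; first exact: (measurable_join_cell F_symbol cf).
  move=> x xu; exists i => //; exists (u i) => //.
  exact: xu i I.
rewrite ge0_integralZl//; last by move=> y _; rewrite integral_ge0.
rewrite -(integral_kernel_mixture dis2)//; last exact/measurable_EFinP.
rewrite integral_orbit_loss muleA -EFinM.
(* For n = 0 the inverse of n is 0, and the bound reduces to nonnegativity of the loss. *)
have [->|n0] := eqVneq n 0%N.
  rewrite mulr0 mul0e integral_ge0// => x _.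
  by rewrite lee_fin; exact: (log_loss_ge0 r_ge0 r_le1).
by rewrite mulVf ?mul1e// pnatr_eq0.
Qed.

End entropy_bound.

(** * Entropy and pressure *)

Section entropy_of_words.
Context {R : realType} {I : finType}.
Variables (p : I -> R) (p0 : forall a, 0 <= p a) (p1 : \sum_a p a = 1).

Lemma word_entropy (n : nat) :
  \sum_(u : {ffun 'I_n -> I}) (\prod_(i < n) p (u i)) * ln (\prod_(i < n) p (u i)) =
  n%:R * \sum_a p a * ln (p a).
Proof.
(* The product rule for x ln x also holds at 0, where every term vanishes. *)
have xlnM (x y : R) : 0 <= x -> 0 <= y ->
    (x * y) * ln (x * y) = y * (x * ln x) + x * (y * ln y).
  rewrite !le_eqVlt => /orP[/eqP <-|x0]; first by rewrite !mul0r mulr0 addr0.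
  move=> /orP[/eqP <-|y0]; first by rewrite !(mul0r, mulr0) addr0.
  by rewrite lnM ?posrE//; ring.
elim: n => [|n IHn].
  rewrite mul0r big1// => u _; by rewrite big_ord0 ln1 mulr0.
rewrite sum_ffun_cons.
under eq_bigr => a _.
  under eq_bigr => v _.
    rewrite big_ord_recl ffunE unlift_none.
    under eq_bigr => i _ do rewrite ffunE liftK.
    rewrite xlnM//; last exact: prodr_ge0.
    over.
  rewrite big_split/= -mulr_suml -mulr_sumr IHn.
  rewrite -(bigA_distr_bigA (fun (_ : 'I_n) a => p a)) big1 ?mul1r//.
  over.
by rewrite big_split/= -mulr_suml p1 mul1r -natr1 mulrDl mul1r addrC.
Qed.

End entropy_of_words.

Section potential.
Context {R : realType} {S : markov_shift} {X : pmetricType R}.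
Notation Sigma := (shift_space S).
Notation Past := (past_space S).
Notation A := (alphabet S).
Notation phase := (borel (Sigma * X)%type).
Notation past_phase := (borel (Past * X)%type).
Variables (nu0 : A -> R) (nu0_prob : cylinder_probability nu0).
Local Open Scope ereal_scope.

Lemma log_potentialE (w : Sigma) : log_potential nu0 w = lne (nu0 (symbol w 0))%:E.
Proof.
rewrite /log_potential (bigD1 (symbol w 0))//= big1 ?adde0.
  by rewrite indicE mem_set ?mul1e.
by move=> a aw; rewrite indicE memNset ?mul0e// => wa; move/eqP : aw; apply.
Qed.

Lemma nu0_le1 a : (nu0 a <= 1)%R.
Proof.
by have [n0 <-] := nu0_prob; rewrite (bigD1 a)//= lerDl; exact: sumr_ge0.
Qed.

Lemma integral_log_potential (eta : probability phase R) :
  \int[eta]_x log_potential nu0 x.1 =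
  - \sum_(a : A) (- lne (nu0 a)%:E) * eta (first_symbol_cell a).
Proof.
have c0 a : 0 <= - lne (nu0 a)%:E by rewrite oppe_ge0 lne_le0 lee_fin nu0_le1.
transitivity (\int[eta]_x (- \sum_(a : A)
    (- lne (nu0 a)%:E) * (\1_(first_symbol_cell a : set phase) x)%:E)).
  apply: eq_integral => x _; rewrite log_potentialE (bigD1 (symbol x.1 0))//= big1 ?adde0.
    by rewrite indicE mem_set// mule1 oppeK.
  by move=> a ax; rewrite indicE memNset ?mule0// => -[/= xa _]; move/eqP : ax; apply.
have mI a : measurable_fun setT
    (fun x : phase => (\1_(first_symbol_cell a : set phase) x)%:E).
  by apply/measurable_EFinP; apply: measurable_indic; exact: measurable_cell.
have s0 (x : phase) : 0 <= \sum_(a : A)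
    (- lne (nu0 a)%:E) * (\1_(first_symbol_cell a : set phase) x)%:E.
  by apply: sume_ge0 => a _; rewrite mule_ge0.
rewrite integral_ge0N//; congr (- _); rewrite ge0_integral_sum//; last 2 first.
- by move=> a; exact: measurable_funeM.
- by move=> a x _; rewrite mule_ge0.
apply: eq_bigr => a _; rewrite ge0_integralZl// integral_indic ?setIT//.
exact: measurable_cell.
Qed.

(** This disposes of the measures that charge a symbol of mass 0: their pressure is -oo. *)
Lemma integral_log_potential_null (eta : probability phase R) (a : A) :
  nu0 a = 0%R -> eta (first_symbol_cell a) != 0 ->
  \int[eta]_x log_potential nu0 x.1 = -oo.
Proof.
move=> a0 etaa; rewrite integral_log_potential (_ : \sum_a _ = +oo)//.
have c0 b : 0 <= - lne (nu0 b)%:E by rewrite oppe_ge0 lne_le0 lee_fin nu0_le1.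
rewrite (bigD1 a)// a0 le0_lneNy// gt0_mulye; last first.
  by rewrite lt_neqAle eq_sym etaa measure_ge0.
rewrite -[LHS]/(+oo + \sum_(i | i != a) - lne (nu0 i)%:E * eta (first_symbol_cell i)).
rewrite addye// gt_eqF// (lt_le_trans (ltNyr 0))// sume_ge0// => b _.
by rewrite mule_ge0.
Qed.

Lemma integral_log_potential_fin (eta : probability phase R) :
  (forall a, nu0 a = 0%R -> eta (first_symbol_cell a) = 0) ->
  \int[eta]_x log_potential nu0 x.1 =
  (\sum_(a : A) fine (eta (first_symbol_cell a)) * ln (nu0 a))%:E.
Proof.
move=> null; rewrite integral_log_potential.
rewrite (eq_bigr (fun a => (- (fine (eta (first_symbol_cell a)) * ln (nu0 a)))%:E)).
  by rewrite sumEFin sumrN EFinN oppeK.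
move=> a _; have [a0|a0] := eqVneq (nu0 a) 0%R.
  by rewrite null// mule0 mul0r oppr0.
have ap : (0 < nu0 a)%R by rewrite lt_neqAle eq_sym a0 nu0_prob.1.
rewrite lne_EFin// EFinN EFinM mulNe muleC fineK// fin_num_measure//.
exact: measurable_cell.
Qed.

End potential.

(** * Pressure bound, equality case and attainment *)

Section variational.
Context {R : realType} {S : markov_shift} {X : pmetricType R}.
Notation Sigma := (shift_space S).
Notation Past := (past_space S).
Notation A := (alphabet S).
Notation phase := (borel (Sigma * X)%type).
Notation past_phase := (borel (Past * X)%type).
Variables (F : Sigma -> X -> X) (f : A -> X -> X).
Hypotheses (F_symbol : forall w, F w = f (symbol w 0)) (cf : forall a, continuous (f a)).
Variables (nu0 : A -> R) (nu0_prob : cylinder_probability nu0).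
Local Open Scope ereal_scope.

Lemma measure_cells (eta : probability phase R) (E : set phase) : measurable E ->
  eta E = \sum_a eta (first_symbol_cell a `&` E).
Proof.
move=> mE; rewrite -measure_bigcup_fintype//.
- congr (eta _); apply/seteqP; split => [x Ex|x [a _ []]//].
  by exists (symbol x.1 0).
- by move=> a; apply: measurableI => //; exact: measurable_cell.
- apply/trivIsetP => a b _ _ ab; apply/seteqP; split => // x.
  move=> [[[/= xa _] _] [[/= xb _] _]].
  by move/eqP : ab; apply; rewrite -xa -xb.
Qed.

Section perturbation.
Variables (eta : probability phase R) (eta_inv : skew_invariant F eta).
Variables (kappa : R.-pker past_phase ~> phase) (eta_dis : disintegration eta kappa).
Hypothesis null : forall a, nu0 a = 0%R -> eta (first_symbol_cell a) = 0.
Variables (D : set (borel X)) (mD : measurable D) (d : A -> R).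
Hypotheses (d_le1 : forall a, (`|d a| <= 1)%R) (d_mean : (\sum_a nu0 a * d a = 0)%R).

Definition cell_mass (a : A) : R := fine (eta (first_symbol_cell a `&` snd @^-1` D)).

Let mD' : measurable (snd @^-1` D : set phase).
Proof. by apply: borel_preimage => //; exact: snd_continuous. Qed.

(** The bound by [log_loss] for the perturbed weights, which sum to 1 because d has mean 0 and stay
    positive on charged symbols because |e| <= 1/2. The logarithm of the product splits, and the
    terms ln nu0_a cancel against the potential. *)
Lemma entropy_along_perturbed (e : R) : (`|e| <= 2^-1)%R ->
  entropy_along F eta kappa + \int[eta]_x log_potential nu0 x.1 <=
  (- \sum_a cell_mass a * ln (1 + e * d a))%:E.
Proof.
move=> e12; have [n0 n1] := nu0_prob.
have ed a : (2^-1 <= 1 + e * d a)%R.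
  have : (`|e * d a| <= 2^-1)%R.
    by rewrite normrM -[leRHS]mulr1 ler_pM.
  by rewrite ler_norml => /andP[]; lra.
have ed0 a : (0 < 1 + e * d a)%R by apply: lt_le_trans (ed a).
pose r a (t : X) : R := (nu0 a * (1 + e * d a * \1_D t))%R.
have rE a t : r a t = (nu0 a * (if t \in D then 1 + e * d a else 1))%R.
  by rewrite /r indicE; case: (t \in D) => /=; rewrite !(mulr1, mulr0, addr0).
have mr a : measurable_fun setT (r a : borel X -> R).
  apply: measurable_funM => //; apply: measurable_funD => //.
  by apply: measurable_funM => //; exact: measurable_indic.
have r0 a t : (0 <= r a t)%R.
  by rewrite rE mulr_ge0//; case: ifP => // _; exact: ltW.
have r1 t : (\sum_a r a t = 1)%R.
  under eq_bigr do rewrite /r mulrDr mulr1 mulrA [(_ * (_ * _))%R]mulrCA.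
  by rewrite big_split/= -mulr_suml -mulr_sumr d_mean n1 mulr0 mul0r addr0.
have r_gt0 a : eta (first_symbol_cell a) = 0 \/ forall t, (0 < r a t)%R.
  have [a0|a0] := eqVneq (nu0 a) 0%R; first by left; exact: null.
  right => t; rewrite rE mulr_gt0//; first by rewrite lt_neqAle eq_sym a0 n0.
  by case: ifP.
have := entropy_along_le_log_loss F_symbol cf eta_inv eta_dis mr r0
  (fun t => eq_ind_r (fun z => z <= 1)%R (lexx _) (r1 t)) r_gt0.
pose Dc a : set phase := first_symbol_cell a `&` snd @^-1` D.
pose Nc a : set phase := first_symbol_cell a `&` ~` (snd @^-1` D).
have mDc a : measurable (Dc a) by apply: measurableI => //; exact: measurable_cell.
have mNc a : measurable (Nc a).
  by apply: measurableI; [exact: measurable_cell|exact: measurableC].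
have cE a : eta (first_symbol_cell a) = eta (Dc a) + eta (Nc a).
  rewrite -measureU//; first by rewrite -setIUr setUv setIT.
  by rewrite /Dc /Nc setIACA setICr setI0.
have fD a : eta (Dc a) \is a fin_num by exact: fin_num_measure.
have fN a : eta (Nc a) \is a fin_num by exact: fin_num_measure.
have -> : \int[eta]_x (log_loss r x)%:E =
    (\sum_a (- ln (nu0 a * (1 + e * d a)) * fine (eta (Dc a)) +
              - ln (nu0 a) * fine (eta (Nc a))))%:E.
  have b0 a : (0 <= - ln (nu0 a))%R by rewrite oppr_ge0 ln_le0// (nu0_le1 nu0_prob).
  (* These weights are nonnegative with sum 1, so each is at most 1 and has a nonpositive
     logarithm. *)
  have q1 : (\sum_a nu0 a * (1 + e * d a) = 1)%R.
    under eq_bigr do rewrite mulrDr mulr1 mulrCA.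
    by rewrite big_split/= -mulr_sumr d_mean n1 mulr0 addr0.
  have a0 a : (0 <= - ln (nu0 a * (1 + e * d a)))%R.
    rewrite oppr_ge0 ln_le0// -[leRHS]q1 (bigD1 a)//= lerDl; apply: sumr_ge0 => b _.
    by rewrite mulr_ge0// ltW.
  transitivity (\int[eta]_x \sum_a ((- ln (nu0 a * (1 + e * d a)))%:E * (\1_(Dc a) x)%:E +
                                    (- ln (nu0 a))%:E * (\1_(Nc a) x)%:E)).
    apply: eq_integral => x _; rewrite (bigD1 (symbol x.1 0))//= big1 ?adde0.
      rewrite /log_loss rE !indicE; have [xD|xD] := boolP (x.2 \in D).
        rewrite mem_set; last by split => //; exact: set_mem.
        by rewrite memNset ?mule1 ?mule0 ?adde0// => -[_ /= /(_ (set_mem xD))].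
      rewrite memNset; last by move=> [_ /= /mem_set]; exact/negP.
      rewrite mem_set ?mule1 ?mule0 ?add0e ?mulr1//.
      by split => // /mem_set; exact/negP.
    move=> a ax; rewrite !indicE !memNset ?mule0 ?adde0//.
      by move=> [[/= xa _] _]; move/eqP : ax; apply.
    by move=> [[/= xa _] _]; move/eqP : ax; apply.
  have mI (B : set phase) : measurable B ->
      measurable_fun setT (fun x => (\1_B x)%:E : \bar R).
    by move=> mB; apply/measurable_EFinP; exact: measurable_indic.
  have mDf a : measurable_fun setT
      (fun x => (- ln (nu0 a * (1 + e * d a)))%:E * (\1_(Dc a) x)%:E).
    by apply: measurable_funeM; exact: mI.
  have mNf a : measurable_fun setT (fun x => (- ln (nu0 a))%:E * (\1_(Nc a) x)%:E).
    by apply: measurable_funeM; exact: mI.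
  rewrite ge0_integral_sum//; last 2 first.
  - by move=> a; exact: emeasurable_funD.
  - by move=> a x _; rewrite adde_ge0// mule_ge0// lee_fin.
  rewrite -sumEFin; apply: eq_bigr => a _; rewrite ge0_integralD//.
  - rewrite !ge0_integralZl// ?lee_fin//; try exact: mI.
    by rewrite !integral_indic// !setIT EFinD !EFinM !fineK.
  - by move=> x _; rewrite mule_ge0// lee_fin.
  - by move=> x _; rewrite mule_ge0// lee_fin.
rewrite (integral_log_potential_fin nu0_prob null) => h.
apply: le_trans (leeD2r _ h) _; rewrite -EFinD lee_fin.
rewrite le_eqVlt; apply/orP; left; apply/eqP.
rewrite -big_split/= -sumrN; apply: eq_bigr => a _.
rewrite cE fineD// /cell_mass -/(Dc a).
have [a0|a0] := eqVneq (nu0 a) 0%R.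
  have : eta (Dc a) + eta (Nc a) = 0 by rewrite -cE null.
  move/eqP; rewrite padde_eq0// => /andP[/eqP -> /eqP ->].
  by rewrite /= !(mulr0, mul0r, addr0) oppr0.
rewrite lnM ?posrE//; first by ring.
by rewrite lt_neqAle eq_sym a0 n0.
Qed.

(** A quantitative first-order condition: [key] bounds e s by 2 e^2 for |e| <= 1/2, and e = s / 4,
    admissible since |s| <= 1, turns this into s^2 / 4 <= s^2 / 8. *)
Lemma cell_mass_mean :
  0 <= entropy_along F eta kappa + \int[eta]_x log_potential nu0 x.1 ->
  (\sum_a cell_mass a * d a = 0)%R.
Proof.
move=> h0.
pose s : R := (\sum_a cell_mass a * d a)%R.
have mc a : measurable (first_symbol_cell a `&` snd @^-1` D : set phase).
  by apply: measurableI => //; exact: measurable_cell.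
have cm0 a : (0 <= cell_mass a)%R by exact: fine_ge0.
have cm1 : (\sum_a cell_mass a <= 1)%R.
  rewrite -lee_fin -sumEFin.
  rewrite (eq_bigr (fun a => eta (first_symbol_cell a `&` snd @^-1` D))).
    by rewrite -measure_cells//; exact: probability_le1.
  by move=> a _; rewrite fineK// fin_num_measure.
have key (e : R) : (`|e| <= 2^-1)%R -> (e * s <= 2 * e ^+ 2)%R.
  move=> e12; have := le_trans h0 (entropy_along_perturbed e12).
  rewrite lee_fin oppr_ge0 => hs.
  rewrite -subr_le0; apply: le_trans hs.
  apply: (@le_trans _ _ (\sum_a cell_mass a * (e * d a - 2 * e ^+ 2))%R).
    under [leRHS]eq_bigr do rewrite mulrBr mulrCA.
    rewrite sumrB -mulr_sumr -/s -mulr_suml lerB// ler_piMl// mulr_ge0 ?sqr_ge0//.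
  apply: ler_sum => a _; apply: ler_wpM2l => //.
  have ed : (`|e * d a| <= 2^-1)%R by rewrite normrM -[leRHS]mulr1 ler_pM.
  have ed2 : ((e * d a) ^+ 2 <= e ^+ 2)%R.
    by rewrite exprMn ler_piMr ?sqr_ge0// -real_normK ?num_real// exprn_ile1.
  set z := (e * d a)%R in ed ed2 *.
  have z0 : (2^-1 <= 1 + z)%R by move: ed; rewrite ler_norml => /andP[]; lra.
  have zp : (0 < 1 + z)%R by apply: lt_le_trans z0.
  (* From ln x <= x - 1 at the inverse of 1 + z comes ln (1 + z) >= z - z^2 / (1 + z); as 1 + z >=
     1/2, the last term is at most 2 e^2. *)
  have : (ln (1 + z)^-1 <= (1 + z)^-1 - 1)%R.
    have := @le_ln1Dx R ((1 + z)^-1 - 1); rewrite [(1 + (_ - 1))%R]addrC subrK; apply.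
    by rewrite ltrBrDr addNr invr_gt0.
  rewrite lnV ?posrE// lerNl; apply: le_trans.
  have -> : (- ((1 + z)^-1 - 1) = z - z ^+ 2 / (1 + z))%R by field; rewrite gt_eqF.
  rewrite lerB// ler_pdivrMr//; apply: le_trans ed2 _.
  rewrite mulrAC ler_peMl ?sqr_ge0//; lra.
have s1 : (`|s| <= 1)%R.
  apply: le_trans (ler_norm_sum _ _ _) _; apply: le_trans cm1; apply: ler_sum => a _.
  by rewrite normrM ger0_norm// ler_piMr.
have : (`|s / 4| <= 2^-1)%R.
  by rewrite normrM (@ger0_norm _ 4^-1)//; lra.
move=> /key; rewrite -/s => h; apply/eqP; rewrite -sqrf_eq0 eq_le sqr_ge0 andbT.
move: h; rewrite exprMn exprVn mulrAC -expr2; lra.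
Qed.

End perturbation.

(** The unperturbed case, with [D] empty, d = 0 and e = 0: Gibbs' inequality with weights [nu0]. *)
Lemma has_entropy_le0 (eta : probability phase R) (h : \bar R) :
  skew_invariant F eta -> has_metric_entropy F eta h ->
  h + \int[eta]_x log_potential nu0 x.1 <= 0.
Proof.
move=> eta_inv [kappa dis ->]; have [n0 n1] := nu0_prob.
have [null|/existsNP[a /not_implyP[a0 /eqP etaa]]] :=
    pselect (forall a, nu0 a = 0%R -> eta (first_symbol_cell a) = 0); last first.
  by rewrite (integral_log_potential_null nu0_prob a0)// addeNy leNye.
have d1 (a : A) : (`|0 : R| <= 1)%R by rewrite normr0.
have d2 : (\sum_a nu0 a * 0 = 0)%R by rewrite big1// => a _; rewrite mulr0.
have e0 : (`|0 : R| <= 2^-1)%R by rewrite normr0.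
apply: le_trans (entropy_along_perturbed eta_inv dis null measurable0 d1 d2 e0) _.
by rewrite big1 ?oppr0// => a _; rewrite mul0r addr0 ln1 mulr0.
Qed.

(** Nonnegative pressure makes the present symbol independent of the fibre point; stationarity is
    then invariance written symbol by symbol. *)
Lemma maximal_pressure_stationary (eta : probability phase R) (h : \bar R) :
  skew_invariant F eta -> has_metric_entropy F eta h ->
  0 <= h + \int[eta]_x log_potential nu0 x.1 ->
  exists2 tau : probability (borel X) R, projects_to eta tau & stationary nu0 f tau.
Proof.
move=> eta_inv [kappa dis ->] h0; have [n0 n1] := nu0_prob.
have null a : nu0 a = 0%R -> eta (first_symbol_cell a) = 0.
  move=> a0; apply/eqP; apply/negPn/negP => etaa.
  by move: h0; rewrite (integral_log_potential_null nu0_prob a0)// addeNy leeNy_eq.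
have [tau tauE] := pushforward_probability eta (@snd_continuous Sigma X).
exists tau => [B mB|B mB]; first by rewrite tauE.
have indep (D : set (borel X)) b : measurable D ->
    eta (first_symbol_cell b `&` snd @^-1` D) = (nu0 b)%:E * eta (snd @^-1` D).
  move=> mD.
  have mE : measurable (snd @^-1` D : set phase).
    by apply: borel_preimage => //; exact: snd_continuous.
  have d1 a : (`|(a == b)%:R - nu0 b| <= 1)%R.
    have := n0 b; have := nu0_le1 nu0_prob b.
    by case: (a == b) => /=; rewrite ler_norml; lra.
  have d2 : (\sum_a nu0 a * ((a == b)%:R - nu0 b) = 0)%R.
    under eq_bigr do rewrite mulrBr.
    rewrite sumrB -mulr_suml n1 mul1r (bigD1 b)//= eqxx mulr1 big1 ?addr0 ?subrr// => a.
    by move=> /negbTE ->; rewrite mulr0.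
  (* The vanishing mean says that [cell_mass b] is nu0_b times the sum of all cell masses, which is
     the mass of the event t in [D]. *)
  have := cell_mass_mean eta_inv dis null mD d1 d2 h0.
  under eq_bigr do rewrite mulrBr.
  rewrite sumrB -mulr_suml (bigD1 b)//= eqxx mulr1 big1 ?addr0; last first.
    by move=> a /negbTE ->; rewrite mulr0.
  move/eqP; rewrite subr_eq0 => /eqP cb.
  have mc a : measurable (first_symbol_cell a `&` snd @^-1` D : set phase).
    by apply: measurableI => //; exact: measurable_cell.
  rewrite (measure_cells eta mE) (eq_bigr (fun a => (cell_mass eta D a)%:E)).
    by rewrite sumEFin -EFinM [(nu0 b * _)%R]mulrC -cb /cell_mass fineK// fin_num_measure.
  by move=> a _; rewrite /cell_mass fineK// fin_num_measure.
have mE : measurable (snd @^-1` B : set phase).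
  by apply: borel_preimage => //; exact: snd_continuous.
(* By invariance [B] may be replaced by its preimage, which over the cell of a is the event that
   [f a] sends t into [B]. *)
rewrite tauE /pushforward -(eta_inv _ mE) measure_cells; last first.
  exact: (measurable_skew_preimage F_symbol cf mE).
apply: eq_bigr => a _; rewrite -indep; last by apply: borel_preimage.
congr (eta _); apply/seteqP; split => -[w t] [[/= wa _]] /=.
  by rewrite F_symbol wa.
by move=> Bt; split => //; rewrite F_symbol wa.
Qed.

Section attained.
Hypotheses (cX : compact [set: X]) (nu0_adm : bernoulli_admissible nu0).

Lemma join_cellE n (u : {ffun 'I_n -> A}) :
  join_cell F u =
  cyl 0 n (fun i => if i is Posz k then word_letter u k else symbol point 0) `*` setT.
Proof.
have iterE i (x : Sigma * X) : symbol (iter i (skew F) x).1 0 = symbol x.1 (Posz i).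
  elim: i x => // i IHi x; rewrite iterSr IHi /skew/= /symbol/=.
  by rewrite -PoszD addn1.
apply/seteqP; split => x.
  move=> xu; split => //; split => // i i_n /=.
  by rewrite -iterE (join_cell_letter xu).
move=> [[_ xk] _] i _; split => //=.
by rewrite /cylinder/= iterE xk// word_letterE.
Qed.

(** Every conditional measure gives words of length n the i.i.d. law, so its entropy is n times that
    of [nu0], and the latter is the opposite of the integral of the potential. *)
Lemma natural_extension_maximal (tau : probability (borel X) R) :
  stationary nu0 f tau ->
  exists eta : probability phase R, exists h : \bar R,
    [/\ skew_invariant F eta, has_metric_entropy F eta h, projects_to eta tau &
        h + \int[eta]_x log_potential nu0 x.1 = 0].
Proof.
move=> tau_st; have [n0 n1] := nu0_prob.
have [eta etaE] := exists_natural_extension cX F_symbol cf nu0_prob nu0_adm tau_st.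
have [kappa dis kE] := natural_extension_disintegration cX nu0_prob nu0_adm etaE.
exists eta, (entropy_along F eta kappa); split.
- exact: (natural_extension_invariant F_symbol cf nu0_prob tau_st etaE).
- by exists kappa.
- exact: (natural_extension_projects etaE).
have cellE a : eta (first_symbol_cell a) = (nu0 a)%:E.
  have := etaE 0%N 1%N (fun=> a) setT openT.
  rewrite /box_mass big_ord0 big_ord1 mul1r/= probability_setT mule1 => <-; congr (eta _).
  apply/seteqP; split => [[w t] [/= wa _]|[w t] [[_ /= /(_ 0%N isT) wa] _]].
    by split => //; split => // -[].
  by split.
have null a : nu0 a = 0%R -> eta (first_symbol_cell a) = 0 by rewrite cellE => ->.
rewrite (integral_log_potential_fin nu0_prob null).
pose H : R := (\sum_a nu0 a * ln (nu0 a))%R.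
have [theta thetaE] := pushforward_probability eta (@continuous_past_map R S X).
have entE n : \int[pushforward eta past_map]_y
    (n%:R^-1 * partition_entropy (kappa y) (@join_cell _ _ _ F n))%:E =
    (n%:R^-1 * (- (n%:R * H)))%:E.
  rewrite -thetaE (eq_integral (cst (n%:R^-1 * (- (n%:R * H)))%:E)); last first.
    move=> y _; congr (_ * _)%:E.
    rewrite /partition_entropy -(word_entropy n0 n1); congr (- _)%R.
    apply: eq_bigr => u _; rewrite join_cellE kE /=.
    by under eq_bigr do rewrite word_letterE.
  by rewrite integral_cst// [X in (_ * X)%E](probability_setT theta) mule1.
have -> : entropy_along F eta kappa = (- H)%:E.
  rewrite /entropy_along (_ : (fun n : nat => _) =
      (fun n : nat => (n%:R^-1 * (- (n%:R * H)))%:E)); last first.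
    by apply/funext => n; exact: entE.
  have cv : (fun n : nat => (n%:R^-1 * (- (n%:R * H)))%:E) @ \oo --> (- H)%:E.
    (* The sequence is constant from n = 1 on; at n = 0 the inverse is 0. *)
    apply: cvg_near_cst; exists 1%N => // n /= n1'.
    by rewrite mulrN mulrA mulVf ?mul1r// pnatr_eq0 -lt0n.
  rewrite is_cvg_limn_esupE; first exact/cvg_lim.
  by apply/cvg_ex; exists (- H)%:E.
rewrite -EFinD (eq_bigr (fun a => nu0 a * ln (nu0 a)))%R; first by rewrite addNr.
by move=> a _; rewrite cellE.
Qed.

End attained.

End variational.

Theorem theorem7p3 (R : realType) (S : markov_shift)
    (transS : topologically_transitive S)
    (X : pmetricType R) (compactX : compact [set: X])
    (alpha : R) (alpha_gt0 : 0 < alpha)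
    (F : shift_space S -> X -> X) (holderF : holder_fibre_maps alpha F)
    (f : alphabet S -> X -> X) (F_symbol : forall w, F w = f (symbol w 0))
    (nu0 : alphabet S -> R) (nu0_prob : cylinder_probability nu0)
    (nu0_adm : bernoulli_admissible nu0) :
  (forall tau : probability (borel X) R, stationary nu0 f tau ->
     exists2 eta : probability (borel (shift_space S * X)%type) R,
       poe_maximizer F (log_potential nu0) eta & projects_to eta tau) /\
  (forall eta : probability (borel (shift_space S * X)%type) R,
     poe_maximizer F (log_potential nu0) eta ->
     exists2 tau : probability (borel X) R,
       projects_to eta tau & stationary nu0 f tau).
Proof.
have [[hF _] [n0 n1]] := (holderF, nu0_prob).
(* Every symbol occurs at index 0 of some point, so each [f a] is one of the homeomorphisms
   [F w]. *)
have cf a : continuous (f a).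
  have [w aw wa] := symbol_occurs a.
  have [_ [g [_ _ cF _]]] := hF (SigSub (mem_set aw)).
  by rewrite -wa -[w 0]/(symbol (SigSub (mem_set aw)) 0) -F_symbol.
have le0 := has_entropy_le0 F_symbol cf nu0_prob.
split => [tau tau_st|eta [eta_inv [h hh hmax]]].
  have [eta [h [inv hh proj h0]]] :=
    natural_extension_maximal F_symbol cf nu0_prob compactX nu0_adm tau_st.
  exists eta => //; split => //; exists h => // eta' h' inv' hh'.
  by rewrite h0; exact: le0.
(* Some stationary measure exists, and its natural extension has pressure 0; a maximizer therefore
   has pressure at least 0. *)
have [tau0 tau0_st] := exists_mixture_invariant n0 n1 cf (@metric_hausdorff _ X) compactX.
have [eta0 [h0 [inv0 hh0 _ h00]]] :=
  natural_extension_maximal F_symbol cf nu0_prob compactX nu0_adm tau0_st.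
apply: (maximal_pressure_stationary F_symbol cf nu0_prob eta_inv hh).
by rewrite -h00; exact: hmax.
Qed.
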